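(* Let $(\mathcal X,d,\mu)$ be an upper doubling and geometrically doubling metric measure space with dominating function $\lambda$. Let $K:(\mathcal X\times\mathcal X)\setminus\triangle\to\mathbb C$ be a $\mu$-locally integrable function satisfying the size condition and the Hörmander condition, let $T$ be a Calderón-Zygmund operator with kernel $K$, and let $T_\ast$ be the corresponding maximal Calderón-Zygmund operator. Suppose that $T$ is bounded on $L^2(\mu)$. Then there exists a positive constant $C_3$ such that, for all $f\in L^2(\mu)\cap L^\infty(\mu)$ and $\mu$-almost every $x\in\mathcal X$, $$T_\ast(f)(x)\le C_3\big[M_{(5)}(Tf)(x)+\|f\|_{L^\infty(\mu)}\big].$$
   Context: Balls: $B(x,r):=\{y\in\mathcal X: d(y,x)<r\}$; for a ball $B$ with center $x_B$ and radius $r_B$ and $\rho>0$, $\rho B:=B(x_B,\rho r_B)$. Upper doubling: a metric measure space $(\mathcal X,d,\mu)$ is upper doubling if $\mu$ is a (nonnegative) Borel measure on $\mathcal X$ and there exist a dominating function $\lambda:\mathcal X\times(0,\infty)\to(0,\infty)$ and a positive constant $C_\lambda$ such that, for each $x\in\mathcal X$, $r\mapsto\lambda(x,r)$ is non-decreasing and, for all $x\in\mathcal X$ and $r\in(0,\infty)$, $$\mu(B(x,r))\le\lambda(x,r)\le C_\lambda\lambda(x,r/2).$$ It is always assumed (this is without loss of generality, by replacing the dominating function) that $\lambda$ also satisfies $\lambda(x,r)\le C_\lambda\lambda(y,r)$ for all $x,y\in\mathcal X$ and $r\in(0,\infty)$ with $d(x,y)\le r$. Geometrically doubling: $(\mathcal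 X,d)$ is geometrically doubling if there exists $N_0\in\mathbb N=\{1,2,\dots\}$ such that every ball $B(x,r)\subset\mathcal X$ has a finite covering by balls $\{B(x_i,r/2)\}_i$ of cardinality at most $N_0$. Let $\triangle:=\{(x,x):x\in\mathcal X\}$. Size condition: there is a constant $C>0$ such that, for all $x,y\in\mathcal X$ with $x\ne y$, $$|K(x,y)|\le \frac{C}{\lambda(x,d(x,y))}.$$ Hörmander condition: there is a constant $C>0$ such that, for all $x,\tilde x\in\mathcal X$ with $x\neq\tilde x$, $$\int_{d(x,y)\ge 2d(x,\tilde x)}\big[|K(x,y)-K(\tilde x,y)|+|K(y,x)-K(y,\tilde x)|\big]\,d\mu(y)\le C.$$ $L_b^\infty(\mu)$ is the space of bounded functions with bounded support. A linear operator $T$ is a Calderón-Zygmund operator with kernel $K$ (satisfying the size and Hörmander conditions) if, for all $f\in L_b^\infty(\mu)$ and $x\notin\operatorname{supp} f$, $$T(f)(x)=\int_{\mathcal X}K(x,y)f(y)\,d\mu(y).$$ $T$ is bounded on $L^2(\mu)$ if $\|Tf\|_{L^2(\mu)}\le C\|f\|_{L^2(\mu)}$ with $C$ independent of $f$; $T$ then denotes also its bounded extension to all of $L^2(\mu)$, so that $Tf\in L^2(\mu)$ is defined for $f\in L^2(\mu)\cap L^\infty(\mu)$. For $\varepsilon\in(0,\infty)$ and $x\in\mathcal X$, set $$T_\varepsilon(f)(x):=\int_{d(x,y)>\varepsilon}K(x,y)f(y)\,d\mu(y),\qquad T_\ast(f)(x):=\sup_{\varepsilon\in(0,\infty)}|T_\varepsilon(f)(x)|;$$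 these are defined for $f\in L_b^\infty(\mu)$, and the same formulas are used for $f\in L^2(\mu)\cap L^\infty(\mu)$. For $g\in L^1_{\mathrm{loc}}(\mu)$ and $x\in\mathcal X$, the Hardy-Littlewood maximal function $M_{(5)}$ is $$M_{(5)}(g)(x):=\sup_{B\ni x}\frac1{\mu(5B)}\int_B|g(y)|\,d\mu(y),$$ the supremum being over all balls $B$ containing $x$. *)

(* Defs.v *)
From HB Require Import structures.
From mathcomp Require Import all_boot all_order all_algebra complex.
From mathcomp Require Import all_classical all_reals all_analysis.

Set Implicit Arguments.
Unset Strict Implicit.
Unset Printing Implicit Defensive.

Import Order.TTheory GRing.Theory Num.Theory.
Import numFieldNormedType.Exports.

Local Open Scope classical_set_scope.
Local Open Scope ring_scope.

(* A metric space equipped with its Borel sigma-algebra; measurable types of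
   the library are pointed, so the space is nonempty. *)
HB.mixin Record isBorelMetric (R : realType) (d : measure_display) X
    & Metric R X & Measurable d X := {
  borel_measurableE : (@measurable d X : set (set X)) = <<s @open X >> }.

#[short(type="borelMetricType")]
HB.structure Definition BorelMetric (R : realType) (d : measure_display) :=
  { X of Metric R X & Measurable d X & isBorelMetric R d X }.

(* The modulus as an element of R: the norm `|z| takes its values in R[i]. *)
Notation cabs := Normc.normc.

Section complex_valued_functions.
Context {R : realType} {d : measure_display} {T : measurableType d}.
Implicit Types (mu : {measure set T -> \bar R}) (D : set T) (f : T -> R[i]).

Definition cmeasurable D f :=
  measurable_fun D (fun x => complex.Re (f x)) /\
  measurable_fun D (fun x => complex.Im (f x)).

(* The library integral is a total function: this has the value of the Lebesgue
   integral of f over D when f is integrable on D. *)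
Definition cintegral mu D f : R[i] :=
  Complex (\int[mu]_(x in D) complex.Re (f x))
          (\int[mu]_(x in D) complex.Im (f x)).

Definition cLnorm mu (p : \bar R) f : \bar R :=
  Lnorm mu p (fun x => (cabs (f x))%:E).

Definition cLspace mu (p : \bar R) f :=
  cmeasurable setT f /\ (cLnorm mu p f < +oo)%E.

End complex_valued_functions.

Section metric_measure_space.
Context {R : realType} {d : measure_display} {X : borelMetricType R d}.
Implicit Types (mu : {measure set X -> \bar R}) (f : X -> R[i]).

(* Only the values lam x r with 0 < r are relevant. *)
Definition upper_doubling mu (lam : X -> R -> R) (Clam : R) :=
  [/\ 0 < Clam,
      forall (x : X) (r : R), 0 < r -> 0 < lam x r,
      forall (x : X) (r s : R), 0 < r -> r <= s -> lam x r <= lam x s,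
      forall (x : X) (r : R), 0 < r ->
        (mu (ball x r) <= (lam x r)%:E)%E /\ lam x r <= Clam * lam x (r / 2)
    & forall (x y : X) (r : R), 0 < r -> mdist x y <= r -> lam x r <= Clam * lam y r].

Definition geometrically_doubling :=
  exists2 N0 : nat, (0 < N0)%N &
    forall (x : X) (r : R), 0 < r ->
      exists2 s : seq X, (size s <= N0)%N &
        ball x r `<=` \bigcup_(c in [set` s]) ball c (r / 2).

Definition off_diagonal : set (X * X) := [set z | z.1 <> z.2].

(* Kernels are total functions of two variables whose values on the diagonal
   are unconstrained and never matter. *)
Implicit Type K : X -> X -> R[i].

(* Local integrability with respect to the product measure of mu with itself. *)
Definition kernel_locally_integrable mu K :=
  cmeasurable off_diagonal (fun z => K z.1 z.2) /\
  forall S : set (X * X), S `<=` off_diagonal -> compact S ->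
    (\int[(mu \x mu)%E]_(z in S) (cabs (K z.1 z.2))%:E < +oo)%E.

Definition size_condition (lam : X -> R -> R) K :=
  exists2 C : R, 0 < C &
    forall x y : X, x <> y -> cabs (K x y) <= C / lam x (mdist x y).

Definition hormander_condition mu K :=
  exists2 C : R, 0 < C &
    forall x x' : X, x <> x' ->
      (\int[mu]_(y in [set y | (2 * mdist x x' <= mdist x y)%R])
        (cabs (K x y - K x' y) + cabs (K y x - K y x'))%:E <= C%:E)%E.

Definition Linfty_b f :=
  [/\ cmeasurable setT f,
      exists M : R, forall x, cabs (f x) <= M
    & exists (x : X) (r : R), [set y | f y <> 0] `<=` ball x r].

Definition csupp f : set X := closure [set y | f y <> 0].

Implicit Types T Tbar : (X -> R[i]) -> (X -> R[i]).

(* Linearity of an operator defined on the class E, modulo null sets. *)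
Definition linear_on mu (E : set (X -> R[i])) T :=
  forall (a : R[i]) f g, E f -> E g ->
    {ae mu, forall x, T (fun y => a * f y + g y) x = a * T f x + T g x}.

Definition calderon_zygmund mu K T :=
  linear_on mu Linfty_b T /\
  forall f, Linfty_b f -> forall x : X, ~ csupp f x ->
    T f x = cintegral mu setT (fun y => K x y * f y).

Definition L2_bounded_on mu (E : set (X -> R[i])) T :=
  exists2 C : R, 0 < C &
    forall f, E f -> cLspace mu 2%:E (T f) /\
      (cLnorm mu 2%:E (T f) <= C%:E * cLnorm mu 2%:E f)%E.

(* Tbar is the bounded linear extension to L^2 of T, initially defined on
   bounded functions with bounded support; these are dense in L^2, so Tbar f is
   determined almost everywhere. *)
Definition L2_extension mu T Tbar :=
  [/\ forall f, Linfty_b f -> {ae mu, forall x, Tbar f x = T f x},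
      linear_on mu (cLspace mu 2%:E) Tbar
    & L2_bounded_on mu (cLspace mu 2%:E) Tbar].

Definition T_eps mu K (eps : R) f (x : X) : R[i] :=
  cintegral mu [set y | eps < mdist x y] (fun y => K x y * f y).

Definition T_star mu K f (x : X) : \bar R :=
  ereal_sup [set (cabs (T_eps mu K eps f x))%:E | eps in [set e : R | 0 < e]].

(* A ball of measure zero contributes 0 to the supremum (0 * 0^-1 = 0 in the
   extended reals); the points covered by a ball B with mu (5B) = 0 form a null
   set in a separable space. *)
Definition M5 mu f (x : X) : \bar R :=
  ereal_sup [set ((\int[mu]_(y in ball b.1 b.2) (cabs (f y))%:E)
                    / mu (ball b.1 (5 * b.2)%R))%E
            | b in [set b : X * R | 0 < b.2 /\ ball b.1 b.2 x]].

End metric_measure_space.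
Arguments geometrically_doubling {R d} X.

(* Main.v *)
Require Import Defs.
From mathcomp Require Import all_boot all_order all_algebra complex.
From mathcomp Require Import all_classical all_reals all_analysis.
From mathcomp Require Import measurable_realfun ring lra.

Set Implicit Arguments.
Unset Strict Implicit.
Unset Printing Implicit Defensive.

Import Order.TTheory GRing.Theory Num.Theory.
Import numFieldNormedType.Exports.

Local Open Scope classical_set_scope.
Local Open Scope ring_scope.

(** The inequality holds at every point [x] of the support of [mu], hence almost
    everywhere: the space is separable, so the complement of the support is null
    ([ae_ball_gt0]).  Fix such an [x], a truncation radius [e] and a bound [F] of
    [f] valid almost everywhere, slightly larger than the sup norm.

    Choice of a radius.  The measure need not be doubling, but along the radii
    [5^k e] the mass of a ball stays below [lam], whose growth is controlled.  So
    there is a first [r = 5^k e] for which the mass of the ball of radius [5 r] is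
    at most a constant times that of the ball of radius [r].  Below it the masses
    increase geometrically faster than [lam], and therefore the size condition
    bounds the integral of [|K x|] over the annulus from [e] to [5 r] by a constant
    ([good_radius]).  This part contributes at most a multiple of [F].

    Comparison with an average.  Let [A] be the region from [5 r] to a large [n].
    When [z] runs over the ball of radius [r], the Hoermander condition changes the
    integral of [K x f] over [A] by at most a multiple of [F] if [x] is replaced by
    [z] ([cintegral_kernel_diff]).  The new integral is [T] applied to the cut-off
    of [f] to [A], evaluated outside its support, that is, [Tbar f (z)] minus the
    value at [z] of [Tbar] applied to the rest of [f] ([CZ_cutoff], [Tbar_split]).
    Averaging over [z] gives ([truncated_average]) an average of [|Tbar f|] over
    the ball, bounded by the maximal function since the masses of the ball and of
    its fivefold dilate are comparable; and an average that the L2 bound of [Tbar]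
    controls, because the rest of [f] has an L2 norm whose square is at most twice
    [F^2] times the mass of the dilated ball, provided [n] is large.

    The region beyond [n].  The truncated integral converges absolutely although
    [f] may have unbounded support: [K x] is square integrable away from [x]
    ([kernel_sqr_integrable]).  This needs a telescoping argument, as [lam] may be
    a bounded function of the radius.  The part beyond [n] is then at most of the
    order of [F] for large [n].  The sum of the three estimates is [T_eps_le];
    letting [F] decrease to the sup norm ends the proof. *)

(** * Separability of geometrically doubling spaces *)

Section metric_topology.
Context {R : realType} {d : measure_display} {X : borelMetricType R d}.
Implicit Types (x y z : X) (r s : R).

Lemma in_ball x y r : ball x r y = (mdist x y < r) :> Prop.
Proof. by rewrite ballEmdist. Qed.

Lemma dist_sym x y : mdist x y = mdist y x :> R.
Proof. exact: metric_sym. Qed.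

Lemma dist_triangle x y z : mdist x z <= mdist x y + mdist y z :> R.
Proof. exact: metric_triangle. Qed.

Lemma open_mball x r : open (ball x r).
Proof.
rewrite openE => y; rewrite in_ball => xy.
rewrite /interior; apply/nbhs_ballP; exists (r - mdist x y) => /=.
  by rewrite subr_gt0.
move=> z; rewrite !in_ball => yz.
have := dist_triangle x y z; lra.
Qed.

Lemma measurable_mball x r : measurable (ball x r).
Proof.
by rewrite borel_measurableE; apply: sub_sigma_algebra; exact: open_mball.
Qed.

Lemma measurable_mdist x : measurable_fun [set: X] (mdist x : X -> R).
Proof.
apply: (@measurability _ _ _ _ _ _ (@RGenInftyO.G R)).
  exact: RGenInftyO.measurableE.
move=> _ [_ [r ->] <-].
rewrite setTI (_ : _ @^-1` _ = ball x r); first exact: measurable_mball.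
by apply/seteqP; split=> y /=; rewrite in_ball in_itv.
Qed.

Lemma measurable_mdist_ge x r : measurable [set y : X | r <= mdist x y].
Proof.
rewrite (_ : mkset _ = ~` ball x r); first exact/measurableC/measurable_mball.
by apply/seteqP; split=> y /=; rewrite in_ball leNgt => /negP.
Qed.

Lemma measurable_mdist_gt x r : measurable [set y : X | r < mdist x y].
Proof.
rewrite (_ : mkset _ = [set: X] `&` mdist x @^-1` `]r, +oo[).
  exact: measurable_mdist.
by rewrite setTI; apply/seteqP; split=> y /=; rewrite in_itv/= andbT.
Qed.

(** Iterating the halving of the radius makes every ball totally bounded. *)
Lemma halving_cover : geometrically_doubling X ->
  forall (x : X) (r : R) (k : nat), 0 < r -> exists s : seq X,
    ball x r `<=` \bigcup_(c in [set` s]) ball c (r / 2 ^+ k).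
Proof.
move=> [N0 _ cov] x r k r0; elim: k => [|k [s sP]].
  exists [:: x] => y xy; exists x; first by rewrite /= inE.
  by rewrite expr0 divr1.
have rk0 : 0 < r / 2 ^+ k by rewrite divr_gt0// exprn_gt0.
have /choice[t tP] c : exists t : seq X,
    ball c (r / 2 ^+ k) `<=` \bigcup_(b in [set` t]) ball b (r / 2 ^+ k / 2).
  by have [t _ tP] := cov c _ rk0; exists t.
exists (flatten [seq t c | c <- s]) => y /sP[c /= cs /tP[b /= bt yb]].
exists b; first by apply/flattenP; exists (t c) => //; exact: map_f.
by rewrite exprSr invfM mulrA.
Qed.

(** The radius comes back as a variable [t], equal to an inverse of a natural
    number, so that it is a single atom for linear arithmetic. *)
Lemma inv_natS_lt r : 0 < r -> exists n (t : R),
  [/\ n.+1%:R^-1 = t, 0 < t & t < r].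
Proof.
move=> r0; exists (Num.truncn r^-1); eexists; split; first reflexivity.
  by rewrite invr_gt0 ltr0n.
by rewrite -[ltRHS]invrK ltf_pV2 ?posrE ?ltr0n ?invr_gt0// truncnS_gt.
Qed.

(** Finite nets, of mesh tending to 0, of the balls of integer radius around one
    point are countably many finite lists; [unpickle] makes one sequence of them. *)
Lemma exists_dense_sequence : geometrically_doubling X -> exists c : nat -> X,
  forall (x : X) (r : R), 0 < r -> exists n, mdist (c n) x < r.
Proof.
move=> dbl; pose x0 : X := point.
have /choice[s sP] (n : nat * nat) : exists s : seq X,
    ball x0 n.1.+1%:R `<=` \bigcup_(c in [set` s]) ball c (n.1.+1%:R / 2 ^+ n.2).
  by apply: halving_cover => //; rewrite ltr0n.
exists (fun m => if @unpickle (nat * nat * nat)%type m is Some (n, i)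
                 then nth x0 (s n) i else x0).
move=> x r r0.
pose m := Num.truncn (mdist x0 x).
have mP : mdist x0 x < m.+1%:R by exact: truncnS_gt.
have m0 : 0 < m.+1%:R :> R by rewrite ltr0n.
pose k := Num.truncn (m.+1%:R / r).
have kP : m.+1%:R / r < 2 ^+ k.+1.
  apply: (lt_le_trans (truncnS_gt _)).
  by rewrite -natrX ler_nat ltnW// ltn_expl.
have := sP (m, k.+1) x; rewrite in_ball => /(_ mP) [c /= cs].
rewrite in_ball => cx.
exists (pickle ((m, k.+1), index c (s (m, k.+1)))); rewrite pickleK nth_index//.
apply: (lt_trans cx); rewrite ltr_pdivrMr ?exprn_gt0//.
by rewrite mulrC -ltr_pdivrMr.
Qed.

(** In a separable space the complement of the diagonal is a countable union of
    rectangles, hence belongs to the product sigma-algebra.  Measurability of the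
    kernel on this set can be exploited only because the set is measurable. *)
Lemma measurable_off_diagonal : geometrically_doubling X ->
  measurable (@off_diagonal R d X).
Proof.
move=> /exists_dense_sequence[c cP].
rewrite (_ : off_diagonal = \bigcup_i \bigcup_n
    (ball (c i) (n.+1%:R^-1 : R) `*` ~` ball (c i) (n.+1%:R^-1 : R))); last first.
  apply/seteqP; split=> [[x y] /= xy|[x y] [i _ [n _ []]]]; last first.
    by move=> /= cx cy; rewrite /off_diagonal /= => xy; apply: cy; rewrite -xy.
  have xy0 : 0 < mdist x y / 2 by rewrite divr_gt0// mdist_gt0; exact/eqP.
  have [n [t [nt t0 txy]]] := inv_natS_lt xy0.
  have [i cx] := cP x _ t0.
  exists i => //; exists n => //=; split; rewrite nt !in_ball//= => cy.
  have := dist_triangle x (c i) y; rewrite (dist_sym x (c i)); lra.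
apply: bigcupT_measurable => i; apply: bigcupT_measurable => n.
by apply: measurableX; [|apply: measurableC]; exact: measurable_mball.
Qed.

(** Almost every point belongs to the support of the measure: a point outside
    it lies in one of countably many balls of measure zero, with centres in a
    dense sequence and radii inverse to natural numbers. *)
Lemma ae_ball_gt0 (mu : {measure set X -> \bar R}) :
  geometrically_doubling X ->
  {ae mu, forall x : X, forall r : R, 0 < r -> (0 < mu (ball x r))%E}.
Proof.
move=> /exists_dense_sequence[c cP].
pose E i n := if `[< mu (ball (c i) (n.+1%:R^-1 : R)) = 0%E >]
  then ball (c i) (n.+1%:R^-1 : R) else set0.
have EN i n : mu.-negligible (E i n).
  apply/negligibleP; rewrite /E; case: asboolP => // _.
  exact: measurable_mball.
apply: negligibleS (negligible_bigcup (fun i => negligible_bigcup (EN i))).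
move=> x /= /existsNP[r] /not_implyP[r0 /negP]; rewrite -leNgt => mu0.
have r20 : 0 < r / 2 by rewrite divr_gt0.
have [n [t [nt t0 tr]]] := inv_natS_lt r20.
have [i cx] := cP x _ t0.
exists i => //; exists n => //; rewrite /E /= nt asboolT ?in_ball//.
apply/eqP; rewrite eq_le measure_ge0 andbT; apply: le_trans mu0.
apply: le_measure; rewrite ?inE; [exact: measurable_mball..|].
move=> y; rewrite !in_ball => cy.
have := dist_triangle x (c i) y; rewrite (dist_sym x (c i)); lra.
Qed.

End metric_topology.

(** * Complex-valued functions and their integrals *)

Section complex_modulus.
Context {R : realType}.
Implicit Types a b : R[i].

Lemma cabs_ge0 a : 0 <= cabs a.
Proof. by case: a => u v; exact: sqrtr_ge0. Qed.

Lemma cabsM a b : cabs (a * b) = cabs a * cabs b.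
Proof. exact: Normc.normcM. Qed.

Lemma cabsD a b : cabs (a + b) <= cabs a + cabs b.
Proof. exact: le_normcD. Qed.

Lemma cabs0 : cabs (0 : R[i]) = 0.
Proof. exact: Normc.normc0. Qed.

Lemma cabsN a : cabs (- a) = cabs a.
Proof. exact: normcN. Qed.

Lemma cabsE a : cabs a = Num.sqrt (complex.Re a ^+ 2 + complex.Im a ^+ 2).
Proof. by case: a. Qed.

Lemma normr_Re_le_cabs a : `|complex.Re a| <= cabs a.
Proof.
by rewrite cabsE -sqrtr_sqr ler_sqrt ?addr_ge0 ?sqr_ge0// lerDl sqr_ge0.
Qed.

Lemma normr_Im_le_cabs a : `|complex.Im a| <= cabs a.
Proof.
by rewrite cabsE -sqrtr_sqr ler_sqrt ?addr_ge0 ?sqr_ge0// lerDr sqr_ge0.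
Qed.

Lemma cabs_le_ReIm a : cabs a <= `|complex.Re a| + `|complex.Im a|.
Proof.
rewrite cabsE -[leRHS]ger0_norm ?addr_ge0// -sqrtr_sqr ler_sqrt ?sqr_ge0//.
by rewrite sqrrD !real_normK ?num_real// addrAC lerDl mulrn_wge0// mulr_ge0.
Qed.

Lemma ReM a b : complex.Re (a * b) =
  complex.Re a * complex.Re b - complex.Im a * complex.Im b.
Proof. by case: a b => [? ?] [? ?]. Qed.

Lemma ImM a b : complex.Im (a * b) =
  complex.Re a * complex.Im b + complex.Im a * complex.Re b.
Proof. by case: a b => [? ?] [? ?]. Qed.

Lemma ReB a b : complex.Re (a - b) = complex.Re a - complex.Re b.
Proof. by case: a b => [? ?] [? ?]. Qed.

Lemma ImB a b : complex.Im (a - b) = complex.Im a - complex.Im b.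
Proof. by case: a b => [? ?] [? ?]. Qed.

End complex_modulus.

Section complex_measurability.
Context {R : realType} {d : measure_display} {T : measurableType d}.
Implicit Types (mu : {measure set T -> \bar R}) (A D : set T) (f g : T -> R[i]).

Lemma cmeasurable_cabs D f : cmeasurable D f ->
  measurable_fun D (fun x => cabs (f x)).
Proof.
move=> [mr mi].
under eq_fun do rewrite cabsE.
apply: (measurableT_comp (continuous_measurable_fun (@sqrt_continuous R))).
by apply: measurable_funD; exact: measurable_funX.
Qed.

Lemma cmeasurable_ecabs D f : cmeasurable D f ->
  measurable_fun D (fun x => (cabs (f x))%:E).
Proof. by move=> /cmeasurable_cabs; exact: measurableT_comp. Qed.

Lemma cmeasurable_ecabs2 D f : cmeasurable D f ->
  measurable_fun D (fun x => (cabs (f x) ^+ 2)%:E).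
Proof.
move=> /cmeasurable_cabs mf; apply: measurableT_comp => //.
exact: measurable_funX.
Qed.

Lemma cmeasurableM D f g : cmeasurable D f -> cmeasurable D g ->
  cmeasurable D (fun x => f x * g x).
Proof.
move=> [fr fi] [gr gi]; split.
- under eq_fun do rewrite ReM.
  by apply: measurable_funB; apply: measurable_funM.
- under eq_fun do rewrite ImM.
  by apply: measurable_funD; apply: measurable_funM.
Qed.

Lemma cmeasurableB D f g : cmeasurable D f -> cmeasurable D g ->
  cmeasurable D (fun x => f x - g x).
Proof.
move=> [fr fi] [gr gi]; split.
- by under eq_fun do rewrite ReB; exact: measurable_funB.
- by under eq_fun do rewrite ImB; exact: measurable_funB.
Qed.

Lemma cmeasurableS A D f : measurable D -> A `<=` D ->
  cmeasurable D f -> cmeasurable A f.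
Proof. by move=> mD AD [fr fi]; split; exact: measurable_funS AD _. Qed.

Definition cutoff A f : T -> R[i] := fun x => if x \in A then f x else 0.

Lemma cutoff_in A f x : A x -> cutoff A f x = f x.
Proof. by move=> Ax; rewrite /cutoff mem_set. Qed.

Lemma cutoff_out A f x : ~ A x -> cutoff A f x = 0.
Proof. by move=> Ax; rewrite /cutoff memNset. Qed.

Lemma cutoffD A f x : f x = cutoff A f x + cutoff (~` A) f x.
Proof.
have [Ax|Ax] := pselect (A x).
  by rewrite cutoff_in// cutoff_out ?addr0// => /(_ Ax).
by rewrite cutoff_out// cutoff_in ?add0r.
Qed.

Lemma Re_cutoff A f : (fun x => complex.Re (cutoff A f x)) =
  (fun x => complex.Re (f x)) \_ A.
Proof. by apply/funext => x; rewrite /cutoff patchE; case: ifP. Qed.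

Lemma Im_cutoff A f : (fun x => complex.Im (cutoff A f x)) =
  (fun x => complex.Im (f x)) \_ A.
Proof. by apply/funext => x; rewrite /cutoff patchE; case: ifP. Qed.

Lemma cmeasurable_cutoff A f : measurable A -> cmeasurable setT f ->
  cmeasurable setT (cutoff A f).
Proof.
move=> mA [fr fi]; split.
- by rewrite Re_cutoff; apply/(measurable_restrictT _ mA); apply: measurable_funTS.
- by rewrite Im_cutoff; apply/(measurable_restrictT _ mA); apply: measurable_funTS.
Qed.

Lemma cintegral_cutoff mu A f g :
  cintegral mu setT (fun x => g x * cutoff A f x) =
  cintegral mu A (fun x => g x * f x).
Proof.
rewrite /cintegral.
rewrite [X in _ = Complex X _]Rintegral_mkcond.
rewrite [X in _ = Complex _ X]Rintegral_mkcond.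
congr Complex; congr Rintegral; apply/funext => x; rewrite /cutoff patchE;
  by case: ifP => // _; rewrite mulr0.
Qed.

Lemma integral_cutoff_sqr mu A f :
  (\int[mu]_x (cabs (cutoff A f x) ^+ 2)%:E =
   \int[mu]_(x in A) (cabs (f x) ^+ 2)%:E)%E.
Proof.
rewrite [RHS]integral_mkcond; apply: eq_integral => x _.
by rewrite /cutoff patchE; case: ifP => // _; rewrite cabs0 expr0n.
Qed.

End complex_measurability.

Section complex_integral.
Context {R : realType} {d : measure_display} {T : measurableType d}.
Context (mu : {measure set T -> \bar R}).
Implicit Types (A B D : set T) (f g : T -> R[i]).
Local Open Scope ereal_scope.

Lemma integral_setU_le A B (h : T -> \bar R) :
  measurable A -> measurable B -> measurable_fun (A `|` B) h ->
  (forall x, 0 <= h x) ->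
  \int[mu]_(x in A `|` B) h x <=
  \int[mu]_(x in A) h x + \int[mu]_(x in B) h x.
Proof.
move=> mA mB mh h0.
have mBA : measurable (B `\` A) by exact: measurableD.
have AB : A `|` B = A `|` (B `\` A).
  apply/seteqP; split=> x [Ax|Bx]; [by left| |by left|by right; case: Bx].
  by have [Ax|Ax] := pselect (A x); [left|right].
have mhB : measurable_fun B h by apply: measurable_funS mh => //; exact: measurableU.
rewrite AB ge0_integral_setU// -?AB//; last first.
  by rewrite disj_set2E setDIK.
by apply: leeD => //; apply: ge0_subset_integral.
Qed.

(** The factor 2 comes from bounding the real and the imaginary parts
    separately; for a non-integrable [f] the right-hand side is infinite. *)
Lemma cintegral_le D f : measurable D -> cmeasurable D f ->
  (cabs (cintegral mu D f))%:E <= 2%:E * \int[mu]_(x in D) (cabs (f x))%:E.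
Proof.
move=> mD mf; have mcf := cmeasurable_ecabs mf; case: mf => [mr mi].
have part (u : T -> R) : measurable_fun D u -> (forall x, (`|u x| <= cabs (f x))%R) ->
    (`|\int[mu]_(x in D) u x|%R)%:E <= \int[mu]_(x in D) (cabs (f x))%:E.
  move=> mu_ uf; apply: (@le_trans _ _ `|\int[mu]_(x in D) (u x)%:E|).
    rewrite /Rintegral; case: (\int[mu]_(x in D) (u x)%:E) => //=.
      by rewrite normr0 leey.
    by rewrite normr0 leey.
  have mu' : measurable_fun D (EFin \o u) by exact/measurable_EFinP.
  apply: (le_trans (le_abse_integral _ _ _)) => //.
  apply: ge0_le_integral => //; first exact: measurableT_comp.
  by move=> x _; rewrite /= lee_fin.
apply: (@le_trans _ _ ((`|\int[mu]_(x in D) complex.Re (f x)| +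
    `|\int[mu]_(x in D) complex.Im (f x)|)%R)%:E).
  by rewrite lee_fin; exact: cabs_le_ReIm.
have I0 : 0 <= \int[mu]_(x in D) (cabs (f x))%:E.
  by apply: integral_ge0 => x _; rewrite lee_fin cabs_ge0.
rewrite EFinD mule_natl mule2n.
by apply: leeD; apply: part => // x; [exact: normr_Re_le_cabs|exact: normr_Im_le_cabs].
Qed.

Definition cintegrable D f :=
  cmeasurable D f /\ \int[mu]_(x in D) (cabs (f x))%:E < +oo.

Lemma cintegrable_ReIm D f : measurable D -> cintegrable D f ->
  mu.-integrable D (EFin \o (fun x => complex.Re (f x))) /\
  mu.-integrable D (EFin \o (fun x => complex.Im (f x))).
Proof.
move=> mD [mf fi]; have mcf := cmeasurable_ecabs mf; case: mf => mr mi.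
have cI : mu.-integrable D (fun x => (cabs (f x))%:E).
  apply/integrableP; split=> //; apply: le_lt_trans fi.
  by under eq_integral do rewrite gee0_abs ?lee_fin ?cabs_ge0//.
split; apply: (le_integrable mD _ _ cI); try exact: measurableT_comp.
- move=> x _; rewrite /= lee_fin [leRHS]ger0_norm ?cabs_ge0//.
  exact: normr_Re_le_cabs.
- move=> x _; rewrite /= lee_fin [leRHS]ger0_norm ?cabs_ge0//.
  exact: normr_Im_le_cabs.
Qed.

Lemma cintegral_setU A B f : measurable A -> measurable B ->
  [disjoint A & B] -> cintegrable (A `|` B) f ->
  cintegral mu (A `|` B) f = (cintegral mu A f + cintegral mu B f)%R.
Proof.
move=> mA mB AB /(cintegrable_ReIm (measurableU _ _ mA mB))[fr fi].
by rewrite /cintegral !Rintegral_setU.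
Qed.

Lemma cintegralB D f g : measurable D -> cintegrable D f -> cintegrable D g ->
  cintegral mu D (fun x => f x - g x)%R = (cintegral mu D f - cintegral mu D g)%R.
Proof.
move=> mD /(cintegrable_ReIm mD)[fr fi] /(cintegrable_ReIm mD)[gr gi].
rewrite [RHS](_ : _ = Complex
   (\int[mu]_(x in D) complex.Re (f x) - \int[mu]_(x in D) complex.Re (g x))%R
   (\int[mu]_(x in D) complex.Im (f x) - \int[mu]_(x in D) complex.Im (g x))%R)//.
rewrite -!RintegralB//; congr Complex; congr Rintegral; apply/funext => x.
  exact: ReB.
exact: ImB.
Qed.

(** All L2 estimates below are made on integrals of squares. *)
Lemma cLnorm2_pow f :
  cLnorm mu 2%:E f `^ 2 = \int[mu]_x (cabs (f x) ^+ 2)%:E.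
Proof.
rewrite /cLnorm poweR_Lnorm//; apply: eq_integral => x _.
by rewrite gee0_abs ?lee_fin ?cabs_ge0// poweR_EFin powR_mulrn ?cabs_ge0.
Qed.

Lemma cLnorm2_finE f :
  (cLnorm mu 2%:E f < +oo) = (\int[mu]_x (cabs (f x) ^+ 2)%:E < +oo).
Proof.
rewrite -cLnorm2_pow; have := Lnorm_ge0 mu 2%:E (fun x => (cabs (f x))%:E).
rewrite -/(cLnorm _ _ _); case: (cLnorm mu 2%:E f) => [r _| _|//].
  by rewrite poweR_EFin !ltry.
by rewrite poweRE eqxx pnatr_eq0.
Qed.

Lemma cLnorm2_le (C : R) f g : (0 <= C)%R ->
  cLnorm mu 2%:E g <= C%:E * cLnorm mu 2%:E f ->
  \int[mu]_x (cabs (g x) ^+ 2)%:E <= (C ^+ 2)%:E * \int[mu]_x (cabs (f x) ^+ 2)%:E.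
Proof.
move=> C0 gf; rewrite -!cLnorm2_pow.
have -> : (C ^+ 2)%:E = C%:E `^ 2 by rewrite poweR_EFin powR_mulrn.
have N0 h : 0 <= cLnorm mu 2%:E h by exact: Lnorm_ge0.
rewrite -poweRM ?lee_fin//.
by apply: gt0_ler_poweR => //; rewrite in_itv /= leey andbT ?mule_ge0.
Qed.

End complex_integral.

Section integral_bounds.
Context {R : realType} {d : measure_display} {T : measurableType d}.
Context (mu : {measure set T -> \bar R}).
Implicit Types (A B D N : set T) (u v f : T -> R[i]).

Lemma integral_pow_le_bound D f (M : R) (p : nat) :
  measurable D -> cmeasurable D f -> 0 <= M -> (forall y, D y -> cabs (f y) <= M) ->
  (\int[mu]_(y in D) (cabs (f y) ^+ p)%:E <= (M ^+ p)%:E * mu D)%E.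
Proof.
move=> mD mf M0 fM; rewrite -integral_cst//; apply: ge0_le_integral => //.
- by move=> y _; rewrite lee_fin exprn_ge0 ?cabs_ge0.
- by apply: measurableT_comp => //; apply: measurable_funX; exact: cmeasurable_cabs.
- by move=> y Dy; rewrite lee_fin lerXn2r ?nnegrE ?cabs_ge0 ?fM.
Qed.

(** The Cauchy-Schwarz inequality in additive form: [v] enters an average
    over [B] only through its L2 norm, since [w <= c + w^2 / c] for [c > 0].
    The weight [c] is later taken of the size of the sup norm of the function. *)
Lemma le_integral_average B u v (a b c : R) :
  measurable B -> cmeasurable setT u -> cmeasurable setT v ->
  0 <= a -> 0 <= b -> 0 < c ->
  {ae mu, forall z, B z -> a <= b + cabs (u z) + cabs (v z)} ->
  (a%:E * mu B <= (b + c)%:E * mu B + (\int[mu]_(z in B) (cabs (u z))%:E +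
     c^-1%:E * \int[mu]_z (cabs (v z) ^+ 2)%:E))%E.
Proof.
move=> mB mu_ mv a0 b0 c0 H; rewrite -!integral_cst//.
have mu1 : measurable_fun B (fun z => (cabs (u z))%:E).
  exact/measurable_funTS/cmeasurable_ecabs.
have mv2 : measurable_fun setT (fun z => (cabs (v z) ^+ 2)%:E).
  exact/cmeasurable_ecabs2.
have mv1 : measurable_fun B (fun z => c^-1%:E * (cabs (v z) ^+ 2)%:E)%E.
  by apply: measurable_funeM; exact: measurable_funTS.
have u0 z : (0 <= (cabs (u z))%:E)%E by rewrite lee_fin cabs_ge0.
have v20 z : (0 <= (cabs (v z) ^+ 2)%:E)%E by rewrite lee_fin sqr_ge0.
have v0 z : (0 <= c^-1%:E * (cabs (v z) ^+ 2)%:E)%E.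
  by rewrite mule_ge0// lee_fin invr_ge0 ltW.
have bc0 : (0 <= (b + c)%:E)%E by rewrite lee_fin addr_ge0// ltW.
have muv := emeasurable_funD mu1 mv1.
apply: (@le_trans _ _ (\int[mu]_(z in B) ((b + c)%:E + ((cabs (u z))%:E +
    c^-1%:E * (cabs (v z) ^+ 2)%:E)))%E).
  apply: ae_ge0_le_integral => //.
  - by move=> z _; rewrite !adde_ge0.
  - exact: emeasurable_funD.
  apply: filterS H => z Hz Bz; rewrite -EFinM -!EFinD lee_fin.
  apply: (le_trans (Hz Bz)).
  suff : cabs (v z) <= c + c^-1 * cabs (v z) ^+ 2 by lra.
  have w0 := cabs_ge0 (v z); move: (cabs (v z)) w0 => w w0.
  rewrite -(ler_pM2l c0) mulrDr mulrA divff ?gt_eqF// mul1r -expr2.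
  have := sqr_ge0 (c - w); nra.
rewrite ge0_integralD//; last first.
  by move=> z _; rewrite adde_ge0.
apply: leeD => //; rewrite ge0_integralD//; apply: leeD => //.
rewrite ge0_integralZl//; last 2 first.
- exact: measurable_funTS.
- by rewrite lee_fin invr_ge0 ltW.
by apply: lee_wpmul2l; [rewrite lee_fin invr_ge0 ltW|exact: ge0_subset_integral].
Qed.

(** The null set [N] absorbs the points where an essentially bounded function
    exceeds its bound. *)
Lemma integral_cover3 D A B N (h : T -> \bar R) :
  measurable D -> measurable A -> measurable B -> measurable N ->
  measurable_fun (A `|` (B `|` N)) h -> (forall x, 0 <= h x)%E ->
  mu N = 0%E -> D `<=` A `|` (B `|` N) ->
  (\int[mu]_(x in D) h x <= \int[mu]_(x in A) h x + \int[mu]_(x in B) h x)%E.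
Proof.
move=> mD mA mB mN mh h0 N0 DABN.
have mBN : measurable (B `|` N) by exact: measurableU.
have mABN : measurable (A `|` (B `|` N)) by exact: measurableU.
have mhBN : measurable_fun (B `|` N) h.
  by apply: (measurable_funS mABN _ mh) => x; right.
have mhN : measurable_fun N h by apply: (measurable_funS mBN _ mhBN) => x; right.
apply: (le_trans (ge0_subset_integral mu mD mABN mh (fun x _ => h0 x) DABN)).
apply: (le_trans (integral_setU_le mu mA mBN mh h0)); apply: leeD => //.
apply: (le_trans (integral_setU_le mu mB mN mhBN h0)).
by rewrite (null_set_integral _ _ N0) ?adde0.
Qed.

Lemma cLspace2_cutoff A f : measurable A -> cLspace mu 2%:E f ->
  cLspace mu 2%:E (cutoff A f).
Proof.
move=> mA [mf]; rewrite cLnorm2_finE => fi; split; first exact: cmeasurable_cutoff.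
rewrite cLnorm2_finE integral_cutoff_sqr; apply: le_lt_trans fi.
apply: ge0_subset_integral => //; first exact: cmeasurable_ecabs2.
by move=> x _; rewrite lee_fin sqr_ge0.
Qed.

Lemma cLnorm_infty_ae f (F : R) : (0 < mu [set: T])%E ->
  (cLnorm mu +oo f <= F%:E)%E -> {ae mu, forall x, cabs (f x) <= F}.
Proof.
rewrite /cLnorm unlock /= => -> /ess_sup_inf.ess_supP; apply: filterS => x /=.
by rewrite lee_fin ger0_norm ?cabs_ge0.
Qed.

End integral_bounds.

(** * Integrals over balls and annuli *)

Section metric_integrals.
Context {R : realType} {d : measure_display} {X : borelMetricType R d}.
Context (mu : {measure set X -> \bar R}).
Implicit Types (x y z : X) (r s : R) (D : set X).

Definition annulus x r s : set X := [set y | r <= mdist x y < s].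

Lemma annulusE x r s : annulus x r s = ball x s `\` ball x r.
Proof.
apply/seteqP; split=> y /=; rewrite /annulus /= !in_ball.
  by move=> /andP[ry ys]; split=> //; rewrite ltNge ry.
by move=> [-> /negP]; rewrite -leNgt => ->.
Qed.

Lemma measurable_annulus x r s : measurable (annulus x r s).
Proof. by rewrite annulusE; apply: measurableD; exact: measurable_mball. Qed.

Lemma annulus_disj x r s t : [disjoint annulus x r s & annulus x s t].
Proof.
rewrite disj_set2E; apply/eqP/seteqP; split=> // y [] /=.
by rewrite /annulus /= => /andP[_ ys] /andP[]; rewrite leNgt ys.
Qed.

Lemma annulus_cat x r s t : r <= s -> s <= t ->
  annulus x r t = annulus x r s `|` annulus x s t.
Proof.
move=> rs st; apply/seteqP; split=> y; rewrite /annulus /=.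
  by move=> /andP[ry yt]; have [ys|sy] := ltP (mdist x y) s;
    [left; rewrite ry|right; rewrite yt].
by move=> [/andP[-> ys]|/andP[sy ->]]; rewrite ?(lt_le_trans ys st)// (le_trans rs sy).
Qed.

Lemma bigcup_ball x (u : nat -> R) :
  (forall M, exists n, M < u n) -> \bigcup_n ball x (u n) = setT.
Proof.
move=> uoo; apply/seteqP; split=> // y _.
by have [n yn] := uoo (mdist x y); exists n => //; rewrite in_ball.
Qed.

(** The truncations of [D] to balls exhaust it, so by monotone convergence an
    integrable function has small integral far from [x]. *)
Lemma integral_tail_small D x (h : X -> \bar R) (e : R) :
  measurable D -> measurable_fun D h -> (forall y, 0 <= h y)%E ->
  (\int[mu]_(y in D) h y < +oo)%E -> 0 < e ->
  exists N : nat, forall n, (N <= n)%N ->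
    (\int[mu]_(y in D `&` [set y | (n%:R <= mdist x y)%R]) h y <= e%:E)%E.
Proof.
move=> mD mh h0 Doo e0; pose F n := D `&` ball x n%:R.
have mF n : measurable (F n) by apply: measurableI => //; exact: measurable_mball.
have mhF n : measurable_fun (F n) h by apply: (measurable_funS mD _ mh) => y [].
have ndF : {homo F : n m / (n <= m)%N >-> (n <= m)%O}.
  move=> n m nm; apply/subsetPset; apply: setIS => y; rewrite !in_ball => /lt_le_trans.
  by apply; rewrite ler_nat.
have FD : \bigcup_n F n = D.
  rewrite -setI_bigcupr bigcup_ball ?setIT// => M.
  by exists (Num.truncn M).+1; exact: truncnS_gt.
have cvF := @ge0_nondecreasing_set_cvg_integral _ _ _ F h mu ndF mF mhF
  (fun _ _ _ => h0 _).
rewrite FD in cvF.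
have I0 : (0 <= \int[mu]_(y in D) h y)%E by exact: integral_ge0.
have Ifin : (\int[mu]_(y in D) h y)%E \is a fin_num by rewrite ge0_fin_numE.
have [N NP] : exists N, ((\int[mu]_(y in D) h y) - e%:E < \int[mu]_(y in F N) h y)%E.
  apply: contrapT => /forallNP noN.
  have : (\int[mu]_(y in D) h y <= \int[mu]_(y in D) h y - e%:E)%E.
    rewrite -{1}(cvg_lim _ cvF)//; apply: lime_le; first by apply/cvgP: cvF.
    by apply: nearW => n; rewrite leNgt; exact/negP.
  by rewrite -(fineK Ifin) -EFinB lee_fin lerBrDr gerDl leNgt e0.
exists N => n Nn; set G := _ `&` _.
have mG : measurable G by apply: measurableI => //; exact: measurable_mdist_ge.
have DE : D = F N `|` (D `\` F N) by rewrite setDUK// => y [].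
have GD : G `<=` D `\` F N.
  move=> y [Dy /= ny]; split=> // -[_]; rewrite in_ball ltNge => /negP; apply.
  by apply: le_trans ny; rewrite ler_nat.
have mDF : measurable (D `\` F N) by exact: measurableD.
apply: (@le_trans _ _ (\int[mu]_(y in D `\` F N) h y)%E).
  by apply: ge0_subset_integral => //; apply: (measurable_funS mD _ mh) => y [].
have fin1 : (\int[mu]_(y in F N) h y)%E \is a fin_num.
  rewrite ge0_fin_numE ?integral_ge0//; apply: le_lt_trans Doo.
  by apply: ge0_subset_integral => // y [].
rewrite -(leeD2lE _ _ fin1) -ge0_integral_setU// -?DE//; last first.
  by rewrite disj_set2E setDIK.
by rewrite -leeBlDr// ltW.
Qed.

End metric_integrals.

(** * Numerical lemmas *)

Section radii.
Context {R : realType}.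
Implicit Types (m l : nat -> R).

(** The sequence [m] cannot grow by more than the factor [2 * Q] at every step,
    since it is dominated by [l], which grows by at most [Q]; the first step
    without such growth is chosen. *)
Lemma exists_doubling_index (Q : R) m l : 0 < Q -> 0 < m 0%N ->
  (forall n, m n <= l n) -> (forall n, l n.+1 <= Q * l n) ->
  exists k, m k.+1 <= 2 * Q * m k /\ forall j, (j < k)%N -> 2 * Q * m j < m j.+1.
Proof.
move=> Q0 m0 ml lQ.
have [j jP] : exists j, m j.+1 <= 2 * Q * m j.
  apply: contrapT => /forallNP noj.
  have mgrow n : (2 * Q) ^+ n * m 0%N <= m n.
    elim: n => [|n IH]; first by rewrite expr0 mul1r.
    have /negP := noj n; rewrite -ltNge => /ltW; apply: le_trans.
    by rewrite exprS -mulrA ler_pM2l// mulr_gt0.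
  have lgrow n : l n <= Q ^+ n * l 0%N.
    elim: n => [|n IH]; first by rewrite expr0 mul1r.
    by apply: (le_trans (lQ n)); rewrite exprS -mulrA ler_pM2l.
  have bnd n : 2 ^+ n * m 0%N <= l 0%N.
    have := le_trans (mgrow n) (le_trans (ml n) (lgrow n)).
    by rewrite exprMn mulrAC mulrC ler_pM2l ?exprn_gt0.
  have := bnd (Num.truncn (l 0%N / m 0%N)).+1.
  rewrite -ler_pdivlMr// leNgt => /negP; apply.
  apply: (lt_le_trans (truncnS_gt _)).
  by rewrite -natrX ler_nat ltnW// ltn_expl.
have exj : exists j, m j.+1 <= 2 * Q * m j by exists j.
exists (ex_minn exj); case: ex_minnP => k kP kmin; split=> // i ik.
by rewrite ltNge; apply: contraTN ik => /kmin; rewrite -leqNgt.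
Qed.

(** Induction step of a sum dominated by its last term: when [m] grows faster
    than [2 * Q] and [l] slower than [Q], the ratio [m / l] at least doubles. *)
Lemma geometric_step (C Q l l' m m' : R) : 0 < C -> 0 < Q -> 0 < l -> 0 < l' ->
  l' <= Q * l -> 0 <= m' -> 2 * Q * m <= m' ->
  2 * C * Q * (m / l) + C / l * m' <= 2 * C * Q * (m' / l').
Proof.
move=> C0 Q0 l0 l'0 lQ m'0 mm.
have lV : l^-1 <= Q / l'.
  by rewrite -[leLHS]mul1r ler_pdivrMr// mulrAC ler_pdivlMr// mul1r.
apply: (@le_trans _ _ (2 * C * m' * l^-1)).
  rewrite (_ : _ + _ = (C * (2 * Q * m) + C * m') * l^-1); last by ring.
  rewrite ler_pM2r ?invr_gt0//.
  have : C * (2 * Q * m) <= C * m' by rewrite ler_pM2l.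
  lra.
rewrite (_ : 2 * C * Q * _ = 2 * C * m' * (Q / l')); last by ring.
by apply: ler_wpM2l => //; rewrite !mulr_ge0// ltW.
Qed.

(** A discrete form of [dm / m^2 = - d(1 / m)].  Adding [l0] to [m] avoids the
    division by a vanishing mass and is harmless since [l0 <= l]. *)
Lemma telescoping_step (C Q l0 l m w : R) : 0 < C -> 1 <= Q -> 0 < l0 ->
  0 <= m -> 0 <= w -> l0 <= l -> m + w <= Q * l ->
  (C / l) ^+ 2 * w <= (2 * C * Q) ^+ 2 * ((l0 + m)^-1 - (l0 + (m + w))^-1).
Proof.
move=> C0 Q1 l00 m0 w0 l0l mwQ.
have l_gt0 : 0 < l by exact: lt_le_trans l0l.
have lQ : l0 <= Q * l by apply: (le_trans l0l); rewrite ler_peMl// ltW.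
set a := l0 + m; set b := l0 + (m + w).
have a0 : 0 < a by rewrite /a; lra.
have b0 : 0 < b by rewrite /b; lra.
have aQ : a <= 2 * (Q * l) by rewrite /a; lra.
have bQ : b <= 2 * (Q * l) by rewrite /b; lra.
have Ql0 : 0 < 2 * (Q * l) by exact: lt_le_trans aQ.
have -> : a^-1 - b^-1 = w / (a * b).
  have -> : w = b - a by rewrite /a /b; ring.
  by field; rewrite !gt_eqF.
have ab : a * b <= (2 * (Q * l)) ^+ 2 by rewrite expr2 ler_pM// ltW.
apply: (@le_trans _ _ ((2 * C * Q) ^+ 2 * (w / (2 * (Q * l)) ^+ 2))).
  rewrite le_eqVlt; apply/orP; left; apply/eqP; field.
  by rewrite !gt_eqF//; lra.
apply: ler_wpM2l; first exact: sqr_ge0.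
apply: ler_wpM2l => //; rewrite lef_pV2 ?posrE ?exprn_gt0//.
by rewrite mulr_gt0.
Qed.

End radii.

(** [2 * CH] is the oscillation of the kernel integral over the averaging ball;
    [1] and [4 * CT^2 * Q] come from the L2 part of the average, [2 * Q] from the
    comparison of the ball with its fivefold dilate, and [8 * CK * Q + 2] from the
    part of the integral close to the centre and the part far away. *)
Definition cotlar_constant {R : realType} (CH CT Q CK : R) : R :=
  2 * CH + 1 + 4 * CT ^+ 2 * Q + 2 * Q + 8 * CK * Q + 2.

Lemma cotlar_constantP {R : realType} (CH CT Q CK F : R)
    (C3 := cotlar_constant CH CT Q CK) :
  0 < CH -> 0 < Q -> 0 < CK -> 0 < F -> 0 < C3 /\
  forall M, 0 <= M -> (2 * CH + 1 + 4 * CT ^+ 2 * Q) * F + 2 * Q * M +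
    2 * (4 * CK * Q * F + F) <= C3 * (M + F).
Proof.
move=> CH0 Q0 CK0 F0; rewrite /C3 /cotlar_constant.
have TQ : 0 <= CT ^+ 2 * Q by rewrite mulr_ge0 ?sqr_ge0 ?ltW.
have KQ : 0 < CK * Q by rewrite mulr_gt0.
split=> [|M M0]; first by lra.
have QF : 0 < Q * F by rewrite mulr_gt0.
have TM : 0 <= (2 * CH + 1 + 4 * (CT ^+ 2 * Q) + 8 * (CK * Q) + 2) * M.
  by apply: mulr_ge0 => //; lra.
lra.
Qed.

(** * Estimates for the kernel and for the truncated operators *)

Section cotlar.
Context {R : realType} {d : measure_display} {X : borelMetricType R d}.
Context (mu : {measure set X -> \bar R}) (lam : X -> R -> R) (Clam : R).
Context (K : X -> X -> R[i]) (T Tbar : (X -> R[i]) -> (X -> R[i])).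
Context (mu_upper_doubling : upper_doubling mu lam Clam)
  (X_doubling : geometrically_doubling X)
  (K_loc_int : kernel_locally_integrable mu K).
Context (CK : R) (CK0 : 0 < CK) (K_size : forall x y : X, x <> y ->
  cabs (K x y) <= CK / lam x (mdist x y)).
Context (CH : R) (CH0 : 0 < CH) (K_hormander : forall x x' : X, x <> x' ->
  (\int[mu]_(y in [set y | (2 * mdist x x' <= mdist x y)%R])
    (cabs (K x y - K x' y) + cabs (K y x - K y x'))%:E <= CH%:E)%E).
Context (T_CZ : calderon_zygmund mu K T)
  (TbarE : forall f, Linfty_b f -> {ae mu, forall x, Tbar f x = T f x})
  (Tbar_linear : linear_on mu (cLspace mu 2%:E) Tbar)
  (CT : R) (CT0 : 0 < CT) (Tbar_bounded : forall f, cLspace mu 2%:E f ->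
    cLspace mu 2%:E (Tbar f) /\
    (cLnorm mu 2%:E (Tbar f) <= CT%:E * cLnorm mu 2%:E f)%E).
Implicit Types (x y z : X) (r s : R) (A D : set X) (f : X -> R[i]).

Let Q := Clam ^+ 3.
Let m x r := fine (mu (ball x r)).

(** The values on the diagonal are arbitrary, whence the restriction to sets
    that avoid the fixed point. *)
Lemma cmeasurable_kernel x D : measurable D -> ~ D x -> cmeasurable D (K x).
Proof.
move=> mD Dx; have [[mr mi] _] := K_loc_int.
have off : [set (x, y) | y in D] `<=` off_diagonal.
  by move=> _ [y Dy <-] xy; apply: Dx; rewrite [x]xy.
have mp := measurable_funTS (pair1_measurable (T2 := X) x) (D := D).
have mO := measurable_off_diagonal X_doubling.
by split; [exact: measurable_comp mO off mr mp|exact: measurable_comp mO off mi mp].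
Qed.

Lemma cmeasurable_kernel_l x D : measurable D -> ~ D x ->
  cmeasurable D (fun y => K y x).
Proof.
move=> mD Dx; have [[mr mi] _] := K_loc_int.
have off : [set (y, x) | y in D] `<=` off_diagonal.
  by move=> _ [y Dy <-] yx; apply: Dx; rewrite -[x]yx.
have mp := measurable_funTS (pair2_measurable (T1 := X) x) (D := D).
have mO := measurable_off_diagonal X_doubling.
by split; [exact: measurable_comp mO off mr mp|exact: measurable_comp mO off mi mp].
Qed.

Lemma lam_gt0 x r : 0 < r -> 0 < lam x r.
Proof. by move=> r0; have [_ + _ _ _] := mu_upper_doubling; exact. Qed.

Lemma lam_le x r s : 0 < r -> r <= s -> lam x r <= lam x s.
Proof. by have [_ _ + _ _] := mu_upper_doubling; exact. Qed.

Lemma mu_ball_le x r : 0 < r -> (mu (ball x r) <= (lam x r)%:E)%E.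
Proof. by move=> r0; have [_ _ _ + _] := mu_upper_doubling => /(_ x r r0)[]. Qed.

(** [lam] is positive and non-decreasing, so doubling forces this. *)
Lemma Clam_ge1 : 1 <= Clam.
Proof.
have [C0 l0 lle H _] := mu_upper_doubling.
have [_ l1] := H point 1 ltr01.
have h0 : (0 : R) < 1 / 2 by rewrite divr_gt0.
have l2 : lam point (1 / 2) <= lam point 1.
  by apply: lle => //; rewrite ler_pdivrMr// mul1r ler1n.
rewrite -(ler_pM2r (lam_gt0 point h0)) [leLHS]mul1r; exact: le_trans l2 l1.
Qed.

Lemma lam_double x r : 0 < r -> lam x (2 * r) <= Clam * lam x r.
Proof.
move=> r0; have [_ _ _ H _] := mu_upper_doubling.
have r2 : 0 < 2 * r by rewrite mulr_gt0.
by have [_] := H x _ r2; rewrite mulrAC divff ?mul1r.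
Qed.

(** Three doublings, as [5 <= 2^3]; this is the origin of [Q = Clam^3]. *)
Lemma lam_quintuple x r : 0 < r -> lam x (5 * r) <= Q * lam x r.
Proof.
move=> r0; have r2 : 0 < 2 * r by rewrite mulr_gt0.
have r4 : 0 < 2 * (2 * r) by rewrite mulr_gt0.
have r5 : 0 < 5 * r by rewrite mulr_gt0.
apply: (@le_trans _ _ (lam x (2 * (2 * (2 * r))))).
  by apply: lam_le => //; rewrite !mulrA ler_pM2r// -!natrM ler_nat.
have C0 : 0 < Clam := lt_le_trans ltr01 Clam_ge1.
apply: (le_trans (lam_double _ r4)); rewrite /Q exprS -mulrA ler_pM2l//.
apply: (le_trans (lam_double _ r2)).
by rewrite expr2 -mulrA ler_pM2l// lam_double.
Qed.

Lemma kernel_le x y r : 0 < r -> r <= mdist x y -> cabs (K x y) <= CK / lam x r.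
Proof.
move=> r0 rxy; apply: (le_trans (K_size _)).
  by move=> xy; move: rxy; rewrite xy mdistxx leNgt r0.
rewrite ler_pM2l// lef_pV2 ?posrE ?lam_gt0//; last exact: lt_le_trans rxy.
exact: lam_le.
Qed.

(** Used with [p = 1] for the annulus estimate and with [p = 2] for the decay of
    the kernel at infinity. *)
Lemma annulus_kernel_pow x r s p : 0 < r ->
  (\int[mu]_(y in annulus x r s) (cabs (K x y) ^+ p)%:E <=
   ((CK / lam x r) ^+ p)%:E * mu (annulus x r s))%E.
Proof.
move=> r0; have := @measurable_annulus _ _ X x r s => mA.
apply: integral_pow_le_bound => //.
- apply: cmeasurable_kernel => //; rewrite /annulus /= mdistxx => /andP[].
  by rewrite leNgt r0.
- by rewrite divr_ge0 ?ltW ?lam_gt0.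
- by move=> y /andP[ry _]; exact: kernel_le.
Qed.

Lemma Q_ge1 : 1 <= Q.
Proof. by rewrite /Q exprn_ege1// Clam_ge1. Qed.

Lemma Q_gt0 : 0 < Q. Proof. exact: lt_le_trans Q_ge1. Qed.

Lemma CKQ_gt0 : 0 < 2 * CK * Q.
Proof. by apply: mulr_gt0 Q_gt0; rewrite mulr_gt0. Qed.

Lemma mu_ballE x r : 0 < r -> mu (ball x r) = (m x r)%:E.
Proof.
move=> r0; rewrite fineK// ge0_fin_numE//.
exact: le_lt_trans (mu_ball_le x r0) (ltry _).
Qed.

Lemma m_ge0 x r : 0 <= m x r.
Proof. exact: fine_ge0. Qed.

Lemma m_le_lam x r : 0 < r -> m x r <= lam x r.
Proof.
by move=> r0; rewrite -lee_fin -mu_ballE//; exact: mu_ball_le.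
Qed.

Lemma radius_gt0 (e : R) n : 0 < e -> 0 < 5 ^+ n * e.
Proof. by move=> e0; rewrite mulr_gt0// exprn_gt0. Qed.

Lemma radius_ge (e : R) n : 0 < e -> e <= 5 ^+ n * e.
Proof. by move=> e0; rewrite ler_peMl ?exprn_ege1 ?ler1n// ltW. Qed.

Lemma radius_leS (e : R) n : 0 < e -> 5 ^+ n * e <= 5 ^+ n.+1 * e.
Proof.
by move=> e0; rewrite exprS -mulrA ler_peMl ?ler1n// ltW// radius_gt0.
Qed.

Lemma mu_annulus x r s : 0 < r -> r <= s ->
  exists2 w, mu (annulus x r s) = w%:E & 0 <= w /\ m x r + w = m x s.
Proof.
move=> r0 rs; have s0 := lt_le_trans r0 rs.
have sub : ball x r `<=` ball x s by move=> y; rewrite !in_ball => /lt_le_trans; exact.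
have mr := measurable_mball x r; have ms := measurable_mball x s.
have E : mu (annulus x r s) = (m x s - m x r)%:E.
  have -> : mu (annulus x r s) = (mu (ball x s) - mu (ball x s `&` ball x r))%E.
    rewrite annulusE; apply: measureD => //.
    exact: le_lt_trans (mu_ball_le x s0) (ltry _).
  by rewrite setIidr// !mu_ballE.
exists (m x s - m x r) => //; split; last by rewrite addrC subrK.
by rewrite -lee_fin -E.
Qed.

Lemma annulus_step x (h : X -> \bar R) (e : R) n (D := annulus x e (5 ^+ n.+1 * e)) :
  0 < e -> measurable_fun D h -> (forall y, 0 <= h y)%E ->
  (\int[mu]_(y in D) h y = \int[mu]_(y in annulus x e (5 ^+ n * e)) h y +
    \int[mu]_(y in annulus x (5 ^+ n * e) (5 ^+ n.+1 * e)) h y)%E.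
Proof.
move=> e0 mh h0.
have DE : D = annulus x e (5 ^+ n * e) `|` annulus x (5 ^+ n * e) (5 ^+ n.+1 * e).
  by apply: annulus_cat; [exact: radius_ge|exact: radius_leS].
rewrite DE ge0_integral_setU -?DE//; try exact: measurable_annulus.
exact: annulus_disj.
Qed.

Lemma cmeasurable_kernel_annulus x (e : R) s : 0 < e ->
  cmeasurable (annulus x e s) (K x).
Proof.
move=> e0; apply: cmeasurable_kernel.
  exact: measurable_annulus.
by rewrite /annulus /= mdistxx => /andP[]; rewrite leNgt e0.
Qed.

Lemma annulus_same x r (h : X -> \bar R) : (\int[mu]_(y in annulus x r r) h y = 0)%E.
Proof. by rewrite annulusE setDv integral_set0. Qed.

(** On the annulus between the radii [5^n e] and [5^(n+1) e] the kernel is at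
    most [CK / lam], and [lam] dominates the mass of the larger ball up to [Q];
    so the squares integrate to a sum that telescopes in the masses of balls. *)
Lemma kernel_annulus_sqr x (e : R) n : 0 < e ->
  (\int[mu]_(y in annulus x e (5 ^+ n * e)) (cabs (K x y) ^+ 2)%:E <=
   ((2 * CK * Q) ^+ 2 *
     ((lam x e)^-1 - (lam x e + m x (5 ^+ n * e))^-1))%:E)%E.
Proof.
move=> e0; have le0 := lam_gt0 x e0.
elim: n => [|n IH].
  rewrite expr0 mul1r annulus_same lee_fin mulr_ge0 ?sqr_ge0// subr_ge0.
  by rewrite lef_pV2 ?posrE ?lerDl ?m_ge0// ltr_wpDr ?m_ge0.
have r0 := radius_gt0 n e0; have rS := radius_leS n e0.
have [w wE [w0 mw]] := mu_annulus x r0 rS.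
rewrite annulus_step//; last 2 first.
- exact/cmeasurable_ecabs2/cmeasurable_kernel_annulus.
- by move=> y; rewrite lee_fin sqr_ge0.
have B := annulus_kernel_pow x (5 ^+ n.+1 * e) 2 r0.
apply: (le_trans (leeD IH B)); rewrite wE -EFinM -EFinD lee_fin.
have S : (CK / lam x (5 ^+ n * e)) ^+ 2 * w <= (2 * CK * Q) ^+ 2 *
   ((lam x e + m x (5 ^+ n * e))^-1 - (lam x e + (m x (5 ^+ n * e) + w))^-1).
  apply: telescoping_step => //; [exact: Q_ge1|exact: m_ge0| |].
    by apply: lam_le => //; exact: radius_ge.
  rewrite mw; apply: (le_trans (m_le_lam _ (radius_gt0 _ e0))).
  by rewrite exprS -mulrA; exact: lam_quintuple.
rewrite mw in S.
move: S; rewrite !mulrBr; lra.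
Qed.

Lemma radius_unbounded (e M : R) : 0 < e -> exists n, M < 5 ^+ n * e.
Proof.
move=> e0; exists (Num.truncn (M / e)).+1; rewrite -ltr_pdivrMr//.
apply: (lt_le_trans (truncnS_gt _)).
by rewrite -natrX ler_nat ltnW// ltn_expl.
Qed.

(** The dominating function may stay bounded, so [lam] alone gives no decay;
    the telescoping bound is uniform in the number of annuli. *)
Lemma kernel_sqr_integrable x (e : R) : 0 < e ->
  (\int[mu]_(y in [set y | (e <= mdist x y)%R]) (cabs (K x y) ^+ 2)%:E < +oo)%E.
Proof.
move=> e0; have le0 := lam_gt0 x e0.
pose F n := annulus x e (5 ^+ n * e).
have mF n : measurable (F n) by exact: measurable_annulus.
have ndF : {homo F : n k / (n <= k)%N >-> (n <= k)%O}.
  move=> n k nk; apply/subsetPset => y /andP[ey yn]; apply/andP; split=> //.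
  by apply: (lt_le_trans yn); rewrite ler_pM2r// ler_weXn2l// ler1n.
have FD : [set y | e <= mdist x y] = \bigcup_n F n.
  apply/seteqP; split=> y /=; last by move=> [n _ /andP[]].
  move=> ey; have [n yn] := radius_unbounded (mdist x y) e0.
  by exists n => //; exact/andP.
rewrite FD.
have cvF := @ge0_nondecreasing_set_cvg_integral _ _ _ F
  (fun y => (cabs (K x y) ^+ 2)%:E) mu ndF mF
  (fun n => cmeasurable_ecabs2 (@cmeasurable_kernel_annulus x e _ e0))
  (fun _ y _ => sqr_ge0 (cabs (K x y))).
rewrite -(cvg_lim _ cvF)//.
apply: (@le_lt_trans _ _ (((2 * CK * Q) ^+ 2 / lam x e)%:E)); last exact: ltry.
apply: lime_le; first by apply/cvgP: cvF.
apply: nearW => n; apply: (le_trans (kernel_annulus_sqr x n e0)).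
rewrite lee_fin; apply: ler_wpM2l; first exact: sqr_ge0.
by rewrite gerBl invr_ge0 addr_ge0 ?m_ge0// ltW.
Qed.

(** For a general measure a ball and its fivefold dilate need not have comparable
    masses, but they do for some radius [5^k e]; for the first one, the masses
    below it grow geometrically relative to [lam], so the integral of the kernel
    over the whole annulus from [e] is of the order of its last term. *)
Lemma good_radius x (e : R) : 0 < e -> (forall r, 0 < r -> (0 < mu (ball x r))%E) ->
  exists2 r, e <= r & (mu (ball x (5 * r)) <= (2 * Q)%:E * mu (ball x r))%E /\
    (\int[mu]_(y in annulus x e (5 * r)) (cabs (K x y))%:E <= (4 * CK * Q)%:E)%E.
Proof.
move=> e0 mu0; have Q0 := Q_gt0.
pose l n := lam x (5 ^+ n * e); pose mm n := m x (5 ^+ n * e).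
have l0 n : 0 < l n by exact: lam_gt0 (radius_gt0 n e0).
have lS n : l n.+1 <= Q * l n.
  rewrite /l exprS -mulrA.
  by apply: lam_quintuple; exact: radius_gt0.
have ml n : mm n <= l n by exact/m_le_lam/radius_gt0.
have mm0 : 0 < mm 0%N by rewrite -lte_fin -mu_ballE ?radius_gt0//; exact/mu0/radius_gt0.
have [k [kP jk]] := exists_doubling_index Q0 mm0 ml lS.
have ge0K y : (0 <= (cabs (K x y))%:E)%E by rewrite lee_fin cabs_ge0.
have mK s := cmeasurable_ecabs (@cmeasurable_kernel_annulus x e s e0).
have step n : (\int[mu]_(y in annulus x (5 ^+ n * e) (5 ^+ n.+1 * e)) (cabs (K x y))%:E
    <= (CK / l n * mm n.+1)%:E)%E.
  have r0 := radius_gt0 n e0; have rS := radius_leS n e0.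
  have [w wE [w0 mw]] := mu_annulus x r0 rS.
  have := annulus_kernel_pow x (5 ^+ n.+1 * e) 1 r0.
  rewrite wE -EFinM => /le_trans; apply; rewrite lee_fin expr1.
  apply: ler_wpM2l; first exact: divr_ge0 (ltW CK0) (ltW (l0 n)).
  by rewrite /mm -mw lerDr m_ge0.
have ind j : (j <= k)%N -> (\int[mu]_(y in annulus x e (5 ^+ j * e)) (cabs (K x y))%:E
    <= (2 * CK * Q * (mm j / l j))%:E)%E.
  elim: j => [_|j IH jk'].
    rewrite expr0 mul1r annulus_same lee_fin.
    exact: (mulr_ge0 (ltW CKQ_gt0) (divr_ge0 (m_ge0 _ _) (ltW (l0 _)))).
  rewrite (annulus_step e0 (mK _) ge0K).
  apply: (le_trans (leeD (IH (ltnW jk')) (step j))).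
  rewrite -EFinD lee_fin; apply: geometric_step => //; first exact: m_ge0.
  exact/ltW/jk.
exists (5 ^+ k * e); first exact: radius_ge.
rewrite mulrA -exprS; split.
  by rewrite !mu_ballE ?radius_gt0// -EFinM lee_fin.
rewrite (annulus_step e0 (mK _) ge0K).
apply: (le_trans (leeD (ind k (leqnn k)) (step k))).
rewrite -EFinD lee_fin.
(* The last annulus is covered by the choice of [k], with [m <= lam]. *)
have mlk : mm k / l k <= 1 by rewrite ler_pdivrMr ?mul1r.
apply: (@le_trans _ _ (2 * CK * Q * (mm k / l k) + 2 * CK * Q * (mm k / l k))).
  rewrite lerD2l.
  rewrite (_ : 2 * CK * Q * (mm k / l k) = CK / l k * (2 * Q * mm k)); last by ring.
  by apply: ler_wpM2l => //; exact: divr_ge0 (ltW CK0) (ltW (l0 k)).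
have : 2 * CK * Q * (mm k / l k) <= 2 * CK * Q * 1 by rewrite ler_pM2l ?CKQ_gt0.
lra.
Qed.

(** The region of the Hoermander condition excludes [x] and [z] themselves, so its
    integrand is measurable there and dominates the difference in the first slot. *)
Lemma hormander_le x z A : measurable A -> x <> z ->
  A `<=` [set y | 2 * mdist x z <= mdist x y] ->
  (\int[mu]_(y in A) (cabs (K x y - K z y))%:E <= CH%:E)%E.
Proof.
move=> mA xz AH; apply: le_trans (K_hormander xz).
set D := [set y | _]; have mD : measurable D by exact: measurable_mdist_ge.
have xz0 : 0 < mdist x z :> R by rewrite mdist_gt0; exact/eqP.
have Dx : ~ D x.
  by rewrite /D /= mdistxx leNgt mulr_gt0.
have Dz : ~ D z by rewrite /D /= leNgt ltr_pMl ?ltr1n.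
have m1 : measurable_fun D (fun y => cabs (K x y - K z y)).
  by apply: cmeasurable_cabs; apply: cmeasurableB;
    exact: cmeasurable_kernel.
have m2 : measurable_fun D (fun y => cabs (K y x - K y z)).
  by apply: cmeasurable_cabs; apply: cmeasurableB; exact: cmeasurable_kernel_l.
apply: (@le_trans _ _ (\int[mu]_(y in D) (cabs (K x y - K z y))%:E)%E).
  apply: ge0_subset_integral => //; first exact/measurable_EFinP.
  by move=> y _; rewrite lee_fin cabs_ge0.
apply: ge0_le_integral => //.
- by move=> y _; rewrite lee_fin cabs_ge0.
- exact/measurable_EFinP.
- by apply/measurable_EFinP; exact: measurable_funD.
- by move=> y _; rewrite lee_fin lerDl cabs_ge0.
Qed.

Lemma cintegrable_kernel x z r s (F : R) A f : 0 < r -> 0 < s -> measurable A ->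
  A `<=` ball x s -> (forall y, A y -> r <= mdist z y) ->
  cmeasurable setT f -> 0 <= F -> (forall y, A y -> cabs (f y) <= F) ->
  cintegrable mu A (fun y => K z y * f y).
Proof.
move=> r0 s0 mA As Az mf F0 fF.
have Az' : ~ A z by move=> /Az; rewrite mdistxx leNgt r0.
have mKf : cmeasurable A (fun y => K z y * f y).
  apply: cmeasurableM; first exact: cmeasurable_kernel.
  exact: cmeasurableS mf.
split=> //.
have l0 := lam_gt0 z r0.
have := @integral_pow_le_bound _ _ _ mu A _ (CK / lam z r * F) 1 mA mKf.
move=> /(_ _ _)/le_lt_trans; apply.
- by rewrite mulr_ge0// divr_ge0// ltW.
- move=> y Ay; rewrite cabsM ler_pM ?cabs_ge0 ?fF//.
  by apply: kernel_le => //; exact: Az.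
apply: lte_mul_pinfty => //.
  by rewrite lee_fin expr1 mulr_ge0// divr_ge0// ltW.
apply: (@le_lt_trans _ _ (mu (ball x s))); last first.
  exact: le_lt_trans (mu_ball_le x s0) (ltry _).
by apply: le_measure; rewrite ?inE//; exact: measurable_mball.
Qed.

(** [A] is at distance at least [5 * r] from [x] and [z] is within [r] of [x],
    so [A] lies in the region where the Hoermander condition compares [x], [z]. *)
Lemma cintegral_kernel_diff x z r s (F : R) A f : 0 < r -> 0 < s -> measurable A ->
  A `<=` annulus x (5 * r) s -> cmeasurable setT f ->
  0 <= F -> (forall y, A y -> cabs (f y) <= F) -> ball x r z ->
  cabs (cintegral mu A (fun y => K x y * f y) - cintegral mu A (fun y => K z y * f y))
   <= 2 * CH * F.
Proof.
move=> r0 s0 mA AA mf F0 fF; rewrite in_ball => xz.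
have [<-|/eqP xNz] := eqVneq x z.
  by rewrite subrr cabs0 !mulr_ge0// ltW.
have As : A `<=` ball x s by move=> y /AA/andP[_]; rewrite in_ball.
have Ar5 y : A y -> 5 * r <= mdist x y by move=> /AA/andP[].
have Ar y : A y -> r <= mdist x y.
  by move=> /Ar5; apply: le_trans; rewrite ler_peMl ?ler1n// ltW.
have Azr y : A y -> r <= mdist z y.
  move=> /Ar5; have := dist_triangle x z y; lra.
have Ix := cintegrable_kernel r0 s0 mA As Ar mf F0 fF.
have Iz := cintegrable_kernel r0 s0 mA As Azr mf F0 fF.
rewrite -lee_fin -cintegralB//.
have mD : cmeasurable A (fun y => K x y - K z y).
  by apply: cmeasurableB; apply: cmeasurable_kernel => //;
    [move=> /Ar|move=> /Azr]; rewrite mdistxx leNgt r0.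
apply: (le_trans (cintegral_le mu _ _)) => //.
  by apply: cmeasurableB; [case: Ix|case: Iz].
rewrite -mulrA EFinM; apply: lee_wpmul2l; first by rewrite lee_fin.
apply: (@le_trans _ _ (\int[mu]_(y in A) (F%:E * (cabs (K x y - K z y))%:E))%E).
  apply: ge0_le_integral => //.
  - by move=> y _; rewrite lee_fin cabs_ge0.
  - by apply: cmeasurable_ecabs; apply: cmeasurableB; [case: Ix|case: Iz].
  - by apply: measurable_funeM; exact: cmeasurable_ecabs.
  - move=> y Ay; rewrite -EFinM lee_fin -mulrBl cabsM mulrC ler_wpM2r ?cabs_ge0//.
    exact: fF.
rewrite ge0_integralZl//; last 2 first.
- exact: cmeasurable_ecabs.
- by move=> y _; rewrite lee_fin cabs_ge0.
rewrite (mulrC CH) EFinM; apply: lee_wpmul2l => //.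
apply: hormander_le => // y /Ar5 /=; lra.
Qed.

Lemma Linfty_b_cutoff x s (F : R) A f : measurable A -> A `<=` ball x s ->
  cmeasurable setT f -> 0 <= F -> (forall y, A y -> cabs (f y) <= F) ->
  Linfty_b (cutoff A f).
Proof.
move=> mA As mf F0 fF; split; first exact: cmeasurable_cutoff.
- exists F => y; rewrite /cutoff; case: ifPn => [/set_mem/fF//|_].
  by rewrite cabs0.
- exists x, s => y /= fy; apply: As; apply: contrapT => Ay.
  by apply: fy; rewrite cutoff_out.
Qed.

(** The averaging ball does not meet the support of the cut-off function, so the
    integral representation of [T] applies at each of its points. *)
Lemma CZ_cutoff x r s A f z : 0 < r -> A `<=` annulus x (5 * r) s ->
  Linfty_b (cutoff A f) -> ball x r z ->
  T (cutoff A f) z = cintegral mu A (fun y => K z y * f y).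
Proof.
move=> r0 AA bf xz; have [_ ->//] := T_CZ; first exact: cintegral_cutoff.
have nz : nbhs z (ball x r) by apply: open_nbhs_nbhs; split => //; exact: open_mball.
move=> /(_ _ nz)[y [/= fy]]; rewrite in_ball => xy; apply: fy.
apply: cutoff_out => /AA/andP[]; rewrite leNgt => /negP[].
by apply: (lt_le_trans xy); rewrite ler_peMl ?ler1n// ltW.
Qed.

(** On the bounded, boundedly supported part the extension is [T] itself, which
    has an integral representation; the remainder is treated in L2. *)
Lemma Tbar_split A f : measurable A -> cLspace mu 2%:E f -> Linfty_b (cutoff A f) ->
  {ae mu, forall z, Tbar f z = T (cutoff A f) z + Tbar (cutoff (~` A) f) z}.
Proof.
move=> mA f2 bf.
have H1 := Tbar_linear 1 (cLspace2_cutoff mA f2) (cLspace2_cutoff (measurableC mA) f2).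
have fE : (fun y => 1 * cutoff A f y + cutoff (~` A) f y) = f.
  by apply/funext => y; rewrite mul1r -cutoffD.
rewrite fE in H1.
apply: filterS2 H1 (TbarE bf) => z -> ->.
by rewrite mul1r.
Qed.

Lemma integral_ball_le_M5 (h : X -> R[i]) x r (c : R) : 0 < r -> 0 < c ->
  mu (ball x (5 * r)) = c%:E ->
  (\int[mu]_(y in ball x r) (cabs (h y))%:E <= c%:E * M5 mu h x)%E.
Proof.
move=> r0 c0 mc; rewrite -lee_pdivrMl//; apply: ereal_sup_ubound.
exists (x, r) => /=; first by split=> //; rewrite in_ball mdistxx.
by rewrite mc inver gt_eqF// muleC.
Qed.

Lemma M5_ge0 (h : X -> R[i]) x : (0 <= M5 mu h x)%E.
Proof.
apply: (@le_trans _ _ ((\int[mu]_(y in ball x (1 : R)) (cabs (h y))%:E) /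
   mu (ball x (5 * 1)%R))%E); last first.
  apply: ereal_sup_ubound; exists (x, 1) => //=.
  by rewrite in_ball mdistxx.
rewrite mule_ge0 ?inve_ge0//.
by apply: integral_ge0 => y _; rewrite lee_fin cabs_ge0.
Qed.

(** By [2 |K f| <= |K|^2 + |f|^2].  This makes the truncated integral of [f]
    additive in the domain, even though [f] has unbounded support. *)
Lemma kernel_fun_integrable x (e : R) f : 0 < e -> cLspace mu 2%:E f ->
  cintegrable mu [set y | e < mdist x y] (fun y => K x y * f y).
Proof.
move=> e0 [mf]; rewrite cLnorm2_finE => f2.
set D := [set y | _].
have mD : measurable D by exact: measurable_mdist_gt.
set E := [set y | e <= mdist x y].
have mE : measurable E by exact: measurable_mdist_ge.
have DE : D `<=` E by move=> y /= /ltW.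
have Ex : ~ E x by rewrite /E /= mdistxx leNgt e0.
have mKE := cmeasurable_kernel mE Ex.
have mKD := cmeasurableS mE DE mKE.
have mfD := cmeasurableS measurableT (subsetT D) mf.
have mKf := cmeasurableM mKD mfD.
split => //.
have mK2 := cmeasurable_ecabs2 mKD; have mf2 := cmeasurable_ecabs2 mfD.
have sq0 (g : X -> R[i]) y : (0 <= (cabs (g y) ^+ 2)%:E)%E by rewrite lee_fin sqr_ge0.
apply: (@le_lt_trans _ _ (\int[mu]_(y in D)
    ((cabs (K x y) ^+ 2)%:E + (cabs (f y) ^+ 2)%:E))%E).
  apply: ge0_le_integral => //.
  - by move=> y _; rewrite lee_fin cabs_ge0.
  - exact: cmeasurable_ecabs.
  - exact: emeasurable_funD.
  - move=> y _; rewrite -EFinD lee_fin cabsM.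
    have := sqr_ge0 (cabs (K x y) - cabs (f y)).
    have := sqr_ge0 (cabs (K x y) + cabs (f y)); nra.
rewrite ge0_integralD//; apply: lte_add_pinfty.
  apply: le_lt_trans (kernel_sqr_integrable x e0).
  by apply: ge0_subset_integral => //; exact: cmeasurable_ecabs2.
apply: le_lt_trans f2.
by apply: ge0_subset_integral => //; exact: cmeasurable_ecabs2.
Qed.

(** For almost every [z] in the ball of radius [r], the integral of [K x f] over
    [A] is close to the one of [K z f], which is the difference of the values at
    [z] of [Tbar f] and of [Tbar] applied to the part of [f] off [A].  Averaging
    over [z] bounds the first by the maximal function and the second by its L2
    norm, whose square is at most of order [F^2] times the mass of the ball. *)
Lemma truncated_average x r s (F : R) A f : 0 < r -> 0 < s -> 0 < F ->
  (forall r, 0 < r -> (0 < mu (ball x r))%E) ->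
  (mu (ball x (5 * r)) <= (2 * Q)%:E * mu (ball x r))%E ->
  measurable A -> A `<=` annulus x (5 * r) s -> (forall y, A y -> cabs (f y) <= F) ->
  cLspace mu 2%:E f ->
  (\int[mu]_(y in ~` A) (cabs (f y) ^+ 2)%:E <=
    (2 * F ^+ 2)%:E * mu (ball x (5 * r)))%E ->
  ((cabs (cintegral mu A (fun y => K x y * f y)))%:E <=
   ((2 * CH + 1 + 4 * CT ^+ 2 * Q) * F)%:E + (2 * Q)%:E * M5 mu (Tbar f) x)%E.
Proof.
move=> r0 s0 F0 mu0 dbl mA AA fF f2 tail; set I := cintegral _ _ _.
have mf : cmeasurable setT f by case: f2.
have As : A `<=` ball x s by move=> y /AA/andP[_]; rewrite in_ball.
have r50 : 0 < 5 * r by rewrite mulr_gt0.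
have bg := Linfty_b_cutoff mA As mf (ltW F0) fF.
have [[mTf _] _] := Tbar_bounded f2.
have e2 := cLspace2_cutoff (measurableC mA) f2.
have [[mTe _] Te] := Tbar_bounded e2.
have Te2 := cLnorm2_le (ltW CT0) Te; rewrite integral_cutoff_sqr in Te2.
have mB := measurable_mball x r.
pose m1 := fine (mu (ball x r)); pose m5 := fine (mu (ball x (5 * r))).
have m1E : mu (ball x r) = m1%:E by exact: mu_ballE.
have m5E : mu (ball x (5 * r)) = m5%:E by exact: mu_ballE.
have m10 : 0 < m1 by rewrite -lte_fin -m1E mu0.
have m50 : 0 < m5 by rewrite -lte_fin -m5E mu0.
rewrite m1E m5E -EFinM lee_fin in dbl.
have M0 := M5_ge0 (Tbar f) x; have IM := integral_ball_le_M5 (Tbar f) r0 m50 m5E.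
have Q0 : 0 < Q by exact: Q_gt0.
(* The pointwise inequality to be averaged over the ball of radius [r]. *)
have key : {ae mu, forall z, ball x r z -> cabs I <=
    2 * CH * F + cabs (Tbar f z) + cabs (Tbar (cutoff (~` A) f) z)}.
  apply: filterS (Tbar_split mA f2 bg) => z Tz xz.
  have := cintegral_kernel_diff r0 s0 mA AA mf (ltW F0) fF xz.
  rewrite -(CZ_cutoff r0 AA bg xz) -/I.
  set Tg := T _ z in Tz *; set Th := Tbar (cutoff _ _) z in Tz *.
  have IE : I = (I - Tg) + (Tbar f z + - Th) by rewrite Tz addrK subrK.
  have L1 := cabsD (I - Tg) (Tbar f z + - Th); rewrite -IE in L1.
  have L2 := cabsD (Tbar f z) (- Th); rewrite cabsN in L2.
  move=> L3; apply: (le_trans L1); rewrite -addrA; exact: lerD.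
have b0 : 0 <= 2 * CH * F by rewrite !mulr_ge0// ltW.
(* The weight is [F], so that both halves of the bound have size [F]. *)
have avg := le_integral_average mB mTf mTe (cabs_ge0 I) b0 F0 key.
case: (M5 mu (Tbar f) x) M0 IM => [M| |//] M0 IM; last first.
  have -> : ((2 * Q)%:E * +oo = +oo)%E by rewrite gt0_muley// lte_fin; exact: mulr_gt0.
  by rewrite addey// leey.
have := le_trans avg (leeD (lexx _) (leeD IM (lee_wpmul2l _ (le_trans Te2
   (lee_wpmul2l _ tail))))).
rewrite m1E m5E -!EFinM -!EFinD !lee_fin => /(_ _ _)H.
have {H} : cabs I * m1 <= (2 * CH * F + F) * m1 +
   (m5 * M + F^-1 * (CT ^+ 2 * (2 * F ^+ 2 * m5))).
  by apply: H; rewrite ?invr_ge0 ?sqr_ge0// ltW.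
rewrite lee_fin in M0.
have -> : F^-1 * (CT ^+ 2 * (2 * F ^+ 2 * m5)) = 2 * CT ^+ 2 * F * m5.
  by field; rewrite gt_eqF.
move=> H; rewrite -(ler_pM2r m10); apply: (le_trans H).
have cf : 0 <= M + 2 * CT ^+ 2 * F.
  by rewrite addr_ge0// !mulr_ge0 ?(ltW F0) ?(ltW CT0).
have := ler_wpM2r cf dbl; lra.
Qed.

Let C3 := cotlar_constant CH CT Q CK.

(** The set [A] consists of the points between the radii [5 * r] and [n] at which
    [f] does not exceed [F].  The integral over [A] is controlled by averaging;
    the annulus from [e] to [5 * r] by the choice of [r]; and [n] is so large that
    the region beyond it matters neither for [K x f] nor for the square of [f]. *)
Lemma T_eps_le x (e F : R) f : 0 < e -> 0 < F ->
  (forall r, 0 < r -> (0 < mu (ball x r))%E) ->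
  cLspace mu 2%:E f -> {ae mu, forall y, cabs (f y) <= F} ->
  ((cabs (T_eps mu K e f x))%:E <= C3%:E * (M5 mu (Tbar f) x + F%:E))%E.
Proof.
move=> e0 F0 mu0 f2 fF.
have Q0 : 0 < Q by exact: Q_gt0.
have [r er [dbl annK]] := good_radius e0 mu0.
have r0 : 0 < r by exact: lt_le_trans er.
have r50 : 0 < 5 * r by rewrite mulr_gt0.
have r5 : e < 5 * r by apply: (le_lt_trans er); rewrite ltr_pMl ?ltr1n.
have mf : cmeasurable setT f by case: f2.
have f2i : (\int[mu]_y (cabs (f y) ^+ 2)%:E < +oo)%E by rewrite -cLnorm2_finE; case: f2.
set D := [set y | e < mdist x y]; have mD : measurable D by exact: measurable_mdist_gt.
have [mKf iKf] := kernel_fun_integrable x e0 f2.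
have mKf' := cmeasurable_ecabs mKf.
pose N := [set y | F < cabs (f y)].
have mN : measurable N.
  rewrite (_ : N = [set: X] `&` (fun y => cabs (f y)) @^-1` `]F, +oo[).
    by apply: (cmeasurable_cabs mf) => //; exact: measurable_itv.
  by rewrite setTI; apply/seteqP; split=> y /=; rewrite in_itv/= andbT.
have N0 : mu N = 0%E.
  apply: measure_negligible => //; apply: negligibleS fF => y.
  by rewrite /N /= ltNge => /negP.
have notN y : ~ N y -> cabs (f y) <= F by move=> /negP; rewrite -leNgt.
pose m5 := fine (mu (ball x (5 * r))).
have m5E : mu (ball x (5 * r)) = m5%:E by exact: mu_ballE.
have m50 : 0 < m5 by rewrite -lte_fin -m5E mu0.
have F2m : 0 < F ^+ 2 * m5 by rewrite mulr_gt0// exprn_gt0.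
have sq0 y : (0 <= (cabs (f y) ^+ 2)%:E)%E by rewrite lee_fin sqr_ge0.
have Kf0 y : (0 <= (cabs (K x y * f y))%:E)%E by rewrite lee_fin cabs_ge0.
have msq := cmeasurable_ecabs2 mf.
(* [F2m] makes the tail of the square comparable with the mass of the dilated ball. *)
have [n1 n1P] := integral_tail_small x measurableT msq sq0 f2i F2m.
have [n2 n2P] := integral_tail_small x mD mKf' Kf0 iKf F0.
pose n := (maxn n1 n2).+1; have n0 : 0 < n%:R :> R by rewrite ltr0n.
have {}n1P := n1P n (leqW (leq_maxl _ _)).
have {}n2P := n2P n (leqW (leq_maxr _ _)).
set far := [set y | n%:R <= mdist x y] in n1P n2P.
have mfar : measurable far by exact: measurable_mdist_ge.
pose A := annulus x (5 * r) n%:R `\` N.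
have mA : measurable A by apply: measurableD => //; exact: measurable_annulus.
have AA : A `<=` annulus x (5 * r) n%:R by move=> y [].
have AD : A `<=` D by move=> y /AA /andP[+ _]; exact: lt_le_trans.
have AF y : A y -> cabs (f y) <= F by move=> [_ /notN].
have sqtail : (\int[mu]_(y in ~` A) (cabs (f y) ^+ 2)%:E <=
    (2 * F ^+ 2)%:E * mu (ball x (5 * r)))%E.
  apply: (@le_trans _ _ (\int[mu]_(y in ball x (5 * r) `\` N) (cabs (f y) ^+ 2)%:E
    + \int[mu]_(y in [set: X] `&` far) (cabs (f y) ^+ 2)%:E)%E).
    apply: (integral_cover3 (N := N)) => //.
    - exact: measurableC.
    - by apply: measurableD => //; exact: measurable_mball.
    - exact: measurableI.
    - exact: measurable_funTS.
    - move=> y Ay; have [Ny|Ny] := pselect (N y); first by right; right.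
      have [yr|ry] := ltP (mdist x y) (5 * r); first by left; rewrite /= in_ball.
      right; left; split=> //; rewrite /far /= leNgt; apply/negP => yn.
      by apply: Ay; split=> //; rewrite /annulus /= ry.
  have -> : ((2 * F ^+ 2)%:E * mu (ball x (5 * r)) =
      (F ^+ 2 * m5)%:E + (F ^+ 2 * m5)%:E)%E.
    by rewrite m5E -EFinM -EFinD; congr EFin; ring.
  apply: leeD => //.
  have mBN : measurable (ball x (5 * r) `\` N).
    by apply: measurableD => //; exact: measurable_mball.
  apply: (le_trans (integral_pow_le_bound mu 2 mBN _ (ltW F0) _)).
  - exact: cmeasurableS mf.
  - by move=> y [_ /notN].
  rewrite [leRHS]EFinM; apply: lee_wpmul2l; first by rewrite lee_fin sqr_ge0.
  rewrite -m5E; apply: le_measure; rewrite ?inE//; exact: measurable_mball.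
have near_far : (\int[mu]_(y in D `\` A) (cabs (K x y * f y))%:E <=
    (4 * CK * Q * F + F)%:E)%E.
  pose B := (annulus x e (5 * r) `\` N) `&` D.
  have mB : measurable B.
    by apply: measurableI => //; apply: measurableD => //; exact: measurable_annulus.
  have BD : B `<=` D by move=> y [].
  have ND : N `&` D `<=` D by move=> y [].
  apply: (@le_trans _ _ (\int[mu]_(y in B) (cabs (K x y * f y))%:E
    + \int[mu]_(y in D `&` far) (cabs (K x y * f y))%:E)%E).
    apply: (integral_cover3 (N := N `&` D)) => //.
    - exact: measurableD.
    - exact: measurableI.
    - exact: measurableI.
    - by apply: (measurable_funS mD) mKf' => y [/BD|[[]|[]]].
    - by apply: (subset_measure0 _ mN _ N0); [exact: measurableI|move=> y []].
    - move=> y [Dy Ay]; have [Ny|Ny] := pselect (N y); first by right; right.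
      have [yr|ry] := ltP (mdist x y) (5 * r).
        by left; split=> //; split=> //; apply/andP; split=> //; exact: ltW.
      right; left; split=> //; rewrite /far /= leNgt; apply/negP => yn.
      by apply: Ay; split=> //; rewrite /annulus /= ry.
  rewrite EFinD; apply: leeD => //.
  have Ann : B `<=` annulus x e (5 * r) by move=> y [[]].
  have mKA := cmeasurable_kernel_annulus x (5 * r) e0.
  have mAnn := measurable_annulus x e (5 * r).
  have mKB := cmeasurable_ecabs (cmeasurableS mAnn Ann mKA).
  apply: (@le_trans _ _ (\int[mu]_(y in B) (F%:E * (cabs (K x y))%:E))%E).
    apply: ge0_le_integral => //.
    - exact: (measurable_funS mD BD).
    - exact: measurable_funeM.
    - move=> y [[_ /notN fy] _].
      by rewrite -EFinM lee_fin cabsM mulrC ler_wpM2r ?cabs_ge0.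
  rewrite ge0_integralZl//; last 2 first.
  - by move=> y _; rewrite lee_fin cabs_ge0.
  - by rewrite lee_fin ltW.
  rewrite (mulrC _ F) [leRHS]EFinM; apply: lee_wpmul2l; first by rewrite lee_fin ltW.
  apply: le_trans annK; apply: ge0_subset_integral => //.
    exact: cmeasurable_ecabs.
  by move=> y _; rewrite lee_fin cabs_ge0.
have DE : D = A `|` (D `\` A) by rewrite setDUK.
have mDA : measurable (D `\` A) by exact: measurableD.
have -> : T_eps mu K e f x = cintegral mu A (fun y => K x y * f y) +
    cintegral mu (D `\` A) (fun y => K x y * f y).
  rewrite /T_eps -/D {1}DE cintegral_setU// -?DE//.
  by rewrite disj_set2E setDIK.
have H1 := truncated_average r0 n0 F0 mu0 dbl mA AA AF f2 sqtail.
have DAD : D `\` A `<=` D by move=> y [].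
have two0 : (0 <= 2%:E :> \bar R)%E by rewrite lee_fin.
have H2 := le_trans (cintegral_le mu mDA (cmeasurableS mD DAD mKf))
  (lee_wpmul2l two0 near_far).
apply: (@le_trans _ _ ((cabs (cintegral mu A (fun y => K x y * f y)) +
    cabs (cintegral mu (D `\` A) (fun y => K x y * f y)))%:E)).
  by rewrite lee_fin cabsD.
rewrite EFinD; apply: (le_trans (leeD H1 H2)).
have [C30 C3P] := cotlar_constantP CT CH0 Q0 CK0 F0; rewrite -/C3 in C30 C3P.
have := M5_ge0 (Tbar f) x; case: (M5 mu (Tbar f) x) => [M| |//]; last first.
  have C3E : (0 < C3%:E)%E by rewrite lte_fin.
  by move=> _; rewrite [leRHS](_ : _ = +oo%E) ?leey// addye// gt0_muley.
by rewrite lee_fin => M0; rewrite -EFinD -!EFinM lee_fin; exact: C3P.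
Qed.

End cotlar.

Theorem theorem3p1 (R : realType) (d : measure_display)
    (X : borelMetricType R d) (mu : {measure set X -> \bar R})
    (lam : X -> R -> R) (Clam : R) (K : X -> X -> R[i])
    (T Tbar : (X -> R[i]) -> (X -> R[i]))
    (mu_upper_doubling : upper_doubling mu lam Clam)
    (X_doubling : geometrically_doubling X)
    (K_loc_int : kernel_locally_integrable mu K)
    (K_size : size_condition lam K)
    (K_hormander : hormander_condition mu K)
    (T_CZ : calderon_zygmund mu K T)
    (T_bounded : L2_bounded_on mu Linfty_b T)
    (Tbar_ext : L2_extension mu T Tbar) :
  exists2 C3 : R, 0 < C3 &
    forall f : X -> R[i], cLspace mu 2%:E f -> cLspace mu +oo%E f ->
      {ae mu, forall x,
        (T_star mu K f x <=
          C3%:E * (M5 mu (Tbar f) x + cLnorm mu +oo f))%E}.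
Proof.
have [CK CK0 Ksize] := K_size.
have [CH CH0 Khor] := K_hormander.
have [TbarE Tbar_linear [CT CT0 Tbar_bounded]] := Tbar_ext.
pose C3 := cotlar_constant CH CT (Clam ^+ 3) CK.
have [C30 _] := cotlar_constantP CT CH0 (Q_gt0 mu_upper_doubling) CK0 ltr01.
exists C3 => // f f2 [_ fy].
apply: filterS (ae_ball_gt0 mu X_doubling) => x mu0.
have muT : (0 < mu [set: X])%E.
  apply: (lt_le_trans (mu0 1 ltr01)).
  by apply: le_measure; rewrite ?inE//; exact: measurable_mball.
have N0 : (0 <= cLnorm mu +oo f)%E by exact: Lnorm_ge0.
have Nfin : cLnorm mu +oo f \is a fin_num by rewrite ge0_fin_numE.
pose Nf := fine (cLnorm mu +oo f).
have NE : cLnorm mu +oo f = Nf%:E by rewrite fineK.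
have Nf0 : 0 <= Nf by rewrite fine_ge0.
apply: ge_ereal_sup => _ [e /= e0 <-].
apply/lee_addgt0Pr => c c0.
have cC : 0 < c / C3 by rewrite divr_gt0.
have F0 : 0 < Nf + c / C3 by rewrite ltr_wpDl.
have fF : {ae mu, forall y, cabs (f y) <= Nf + c / C3}.
  by apply: cLnorm_infty_ae => //; rewrite NE lee_fin lerDl ltW.
have := T_eps_le mu_upper_doubling X_doubling K_loc_int CK0 Ksize CH0 Khor T_CZ TbarE
  Tbar_linear CT0 Tbar_bounded e0 F0 mu0 f2 fF.
move=> /le_trans; apply; rewrite -/C3 NE.
have M0 := M5_ge0 mu (Tbar f) x.
rewrite (EFinD Nf) addeA ge0_muleDr ?adde_ge0 ?lee_fin ?(ltW cC)//.
by rewrite -[(C3%:E * (c / C3)%:E)%E]EFinM mulrCA divff ?mulr1// gt_eqF.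
Qed.
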